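(* Let $\Gamma$ be a tight distance-regular graph with diameter $D\geq 3$, valency $k$, intersection numbers $b_1,c_2$, and eigenvalues $k=\theta_0>\theta_1>\cdots>\theta_D$. Define $b:=b_1/(1+\theta_1)$ and assume $b\geq 2$. Then the following (i) and (ii) hold. (i) If every local graph of $\Gamma$ is the block graph of an orthogonal array and $k>(b+1)^2$, then $c_2\neq (b+1)^2$. (ii) If every local graph of $\Gamma$ is the block graph of a Steiner system and $k>(b+1)(b+2)$, then $c_2\neq (b+1)(b+2)$.
   Context: Graphs are finite, undirected, connected and simple; $\partial$ is the path-length distance, $\Gamma_i(x)=\{y:\partial(x,y)=i\}$, $\Gamma(x)=\Gamma_1(x)$. A connected graph $\Gamma$ with diameter $D$ is distance-regular if for all $0\le h,i,j\le D$ and all vertices $x,y$ with $\partial(x,y)=h$ the number $p^h_{i,j}=|\Gamma_i(x)\cap\Gamma_j(y)|$ depends only on $h,i,j$; write $c_i=p^i_{1,i-1}$, $a_i=p^i_{1,i}$, $b_i=p^i_{1,i+1}$ and $k=b_0$ (the valency). Such a graph has exactly $D+1$ distinct (adjacency) eigenvalues $k=\theta_0>\theta_1>\cdots>\theta_D$. A distance-regular graph with $D\ge 3$ is tight if it is nonbipartite and $$\left(\theta_1+\frac{k}{a_1+1}\right)\left(\theta_D+\frac{k}{a_1+1}\right)=-\frac{k a_1 b_1}{(a_1+1)^2}.$$ The local graph of $\Gamma$ at a vertex $x$ is the subgraph induced on $\Gamma(x)$. An orthogonal array $\operatorname{OA}(p,q)$ is a $p\times q^2$ array with entries in $\{1,\ldots,q\}$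 such that the columns of every $2\times q^2$ subarray (formed by two rows) contain each of the $q^2$ ordered pairs exactly once. Its block graph has the columns as vertices, two distinct columns being adjacent if and only if there is a row in which they have the same entry. A Steiner system $S(2,p,q)$ is a $2$-$(q,p,1)$ design: a collection of $p$-subsets (blocks) of a $q$-set (of points) such that every pair of distinct points is contained in exactly one block. Its block graph has the blocks as vertices, two blocks being adjacent if and only if they intersect in exactly one point. *)

(* Defs.v *)
(* MathComp. *)
From mathcomp Require Import all_boot all_order all_algebra.

Set Implicit Arguments.
Unset Strict Implicit.
Unset Printing Implicit Defensive.

Import Order.TTheory GRing.Theory Num.Theory.

Local Open Scope nat_scope.

(* A graph is its adjacency relation on a finite type of vertices. *)
Definition simple_graph (T : finType) (e : rel T) : Prop :=
  symmetric e /\ irreflexive e.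

Definition connected_graph (T : finType) (e : rel T) : Prop :=
  forall x y : T, connect e x y.

Definition bipartite (T : finType) (e : rel T) : Prop :=
  exists f : T -> bool, forall x y : T, e x y -> f x != f y.

Definition graph_iso (T1 T2 : finType) (e1 : rel T1) (e2 : rel T2) : Prop :=
  exists2 f : T1 -> T2, bijective f & forall u v : T1, e2 (f u) (f v) = e1 u v.

Definition has_walk (T : finType) (e : rel T) (x y : T) (n : nat) : bool :=
  [exists w : n.-tuple T, path e x w && (last x w == y)].

(* Least length of a walk from x to y. When y is reachable from x this length
   is less than #|T|; when it is not, the value is #|T| by default. *)
Definition dist (T : finType) (e : rel T) (x y : T) : nat :=
  find (has_walk e x y) (iota 0 #|T|).

Definition diameter (T : finType) (e : rel T) : nat :=
  \max_(x : T) \max_(y : T) dist e x y.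

(* p h i j stands for the intersection number p^h_{i,j}; only its values at
   h, i, j <= diameter e are constrained. *)
Definition distance_regular (T : finType) (e : rel T)
    (p : nat -> nat -> nat -> nat) : Prop :=
  [/\ simple_graph e, connected_graph e &
      forall h i j : nat,
        h <= diameter e -> i <= diameter e -> j <= diameter e ->
        forall x y : T, dist e x y = h ->
        #|[set z : T | (dist e x z == i) && (dist e y z == j)]| = p h i j].

Definition c_ (p : nat -> nat -> nat -> nat) (i : nat) : nat := p i 1 i.-1.
Definition a_ (p : nat -> nat -> nat -> nat) (i : nat) : nat := p i 1 i.
Definition b_ (p : nat -> nat -> nat -> nat) (i : nat) : nat := p i 1 i.+1.
Definition valency (p : nat -> nat -> nat -> nat) : nat := b_ p 0.

Definition adjacency_mx (R : nzRingType) (T : finType) (e : rel T) :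
    'M[R]_#|T| :=
  (\matrix_(i, j) (e (enum_val i) (enum_val j))%:R)%R.

(* theta 0 > theta 1 > ... > theta (diameter e) are exactly the distinct
   eigenvalues of the graph; theta is unconstrained beyond the diameter. *)
Definition ordered_eigenvalues (R : rcfType) (T : finType) (e : rel T)
    (theta : nat -> R) : Prop :=
  (forall i j : nat, i < j <= diameter e -> (theta j < theta i)%R) /\
  (forall a : R, eigenvalue (adjacency_mx R e) a <->
                 exists2 i : nat, i <= diameter e & a = theta i).

Definition tight (R : rcfType) (T : finType) (e : rel T)
    (p : nat -> nat -> nat -> nat) (theta : nat -> R) : Prop :=
  let k := ((valency p)%:R : R)%R in
  let a1 := ((a_ p 1)%:R : R)%R in
  let b1 := ((b_ p 1)%:R : R)%R in
  [/\ 3 <= diameter e,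
      ~ bipartite e &
      ((theta 1%N + k / (a1 + 1)) * (theta (diameter e) + k / (a1 + 1))
       = - (k * a1 * b1 / (a1 + 1) ^+ 2))%R].

Definition local_vertex (T : finType) (e : rel T) (x : T) : finType :=
  {y : T | e x y}.

Definition local_graph (T : finType) (e : rel T) (x : T) :
    rel (local_vertex e x) :=
  fun u v => e (val u) (val v).

Definition orthogonal_array (m q : nat) (M : 'M['I_q]_(m, q ^ 2)) : Prop :=
  forall i1 i2 : 'I_m, i1 != i2 -> forall s t : 'I_q,
    #|[set j : 'I_(q ^ 2) | (M i1 j == s) && (M i2 j == t)]| = 1.

Definition OA_block_graph (m q : nat) (M : 'M['I_q]_(m, q ^ 2)) :
    rel 'I_(q ^ 2) :=
  fun j1 j2 => (j1 != j2) && [exists i : 'I_m, M i j1 == M i j2].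

Definition is_OA_block_graph (T : finType) (e : rel T) : Prop :=
  exists (m q : nat) (M : 'M['I_q]_(m, q ^ 2)),
    orthogonal_array M /\ graph_iso e (OA_block_graph M).

Definition steiner_system (m q : nat) (B : {set {set 'I_q}}) : Prop :=
  (forall A : {set 'I_q}, A \in B -> #|A| = m) /\
  (forall s t : 'I_q, s != t ->
     #|[set A in B | (s \in A) && (t \in A)]| = 1).

Definition block (q : nat) (B : {set {set 'I_q}}) : finType :=
  {A : {set 'I_q} | A \in B}.

(* The condition A1 != A2 only matters for blocks of size 1. *)
Definition steiner_block_graph (q : nat) (B : {set {set 'I_q}}) :
    rel (block B) :=
  fun A1 A2 => (A1 != A2) && (#|val A1 :&: val A2| == 1).

Definition is_steiner_block_graph (T : finType) (e : rel T) : Prop :=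
  exists (m q : nat) (B : {set {set 'I_q}}),
    steiner_system m B /\ graph_iso e (@steiner_block_graph q B).

(* Main.v *)
Require Import Defs.
From mathcomp Require Import all_boot all_order all_algebra.
From mathcomp Require Import zify ring lra.

Import Order.TTheory GRing.Theory Num.Theory.

(** The proof concerns a single vertex [x].  Its local graph is the point graph
    of a partial geometry with [m] lines on a point, [r] points on a line, and
    [a] points of a line collinear with a given point off that line.  For an
    orthogonal array the points are the columns and [a = m - 1]; for a Steiner
    system the points are the blocks and [a = m].  Everything follows from
    [tight_locally_pg]: in a tight graph with such a local graph [m = b + 1],
    and [c_2] is not [m * (a + 1)] as soon as [r > a + 1] and [m >= 3].

    The spectral half rests on one positive semidefinite matrix for each
    eigenvalue, whose entry at two vertices is the cosine of their distance; by
    [cosine_gram] it is a multiple of its own square, so the vectors on which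
    its quadratic form vanishes are in its kernel.  At the smallest eigenvalue
    [theta_D] the characteristic vector of the clique formed by [x] and a line
    gives [k + r * theta_D >= 0] ([line_bound]).  At [theta_1] a function on the
    neighbours of [x] with zero sum on every line gives
    [(m - 1) * (1 + theta_1) <= b_1] ([local_eigenvalue_bound]).  Tightness
    forces both to be equalities ([tight_extremal]).  The equality for [theta_1]
    is [m = b + 1].  The equality for [theta_D] puts the characteristic vectors
    of these cliques into the kernel; hence for every [z] at distance 2 from [x]
    the set of common neighbours of [x] and [z] meets each line of the local
    geometry in 0 or [a + 1] points ([line_meets_common_neighbours]).

    The combinatorial half supposes [c_2 = m * (a + 1)].  A set of that many
    points meeting lines in 0 or [a + 1] points behaves like the point set of a
    subgeometry: with a point off a line that it meets, it contains all points
    of the line collinear with this point ([subgeometry_closed]).  Moreover any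
    two nonadjacent neighbours of [x] lie in such a common neighbourhood.  Two
    subgeometries through a point [w], which contain different points of a line
    missing [w] not collinear with [w], then force too many points onto a line
    through [w] ([noncollinear_pair_not_covered]).

    Orthogonal arrays with at most one row impose no condition on their
    entries; their block graphs are disjoint unions of cliques, which tightness
    and nonbipartiteness exclude ([tight_not_locally_cliques]). *)

(** * Distances in a connected graph *)

Section Distance.
Set Implicit Arguments.
Unset Strict Implicit.
Variables (T : finType) (e : rel T).
Implicit Types (x y z : T) (w : seq T) (n i : nat).

Lemma has_walkP x y n :
  reflect (exists w, [/\ size w = n, path e x w & last x w = y])
          (has_walk e x y n).
Proof.
apply: (iffP existsP) => [[w /andP[pw /eqP lw]]|[w [sw pw lw]]].
  by exists w; rewrite size_tuple.
by move/eqP: sw => sw; exists (Tuple sw); rewrite /= pw lw eqxx.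
Qed.

Lemma dist_leq x w : path e x w -> dist e x (last x w) <= size w.
Proof.
move=> pw; rewrite /dist; set a := has_walk _ _ _.
have aw : a (size w) by apply/has_walkP; exists w.
have [lt_wT|le_Tw] := ltnP (size w) #|T|; last first.
  by apply: leq_trans (find_size _ _) _; rewrite size_iota.
rewrite leqNgt; apply/negP => /(before_find 0).
by rewrite nth_iota // add0n aw.
Qed.

Lemma dist_xx x : dist e x x = 0.
Proof. by apply/eqP; rewrite -leqn0 (@dist_leq x [::]). Qed.

Lemma dist_le_diameter x y : dist e x y <= diameter e.
Proof.
apply: leq_trans (leq_bigmax x).
by apply: (leq_bigmax (F := fun y => dist e x y)).
Qed.

Hypothesis e_connected : connected_graph e.

Lemma dist_walk x y :
  exists w, [/\ size w = dist e x y, path e x w & last x w = y].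
Proof.
apply/has_walkP; rewrite /dist; set a := has_walk e x y; rewrite -/(a _).
have [w0 pw0 lw0] := connectP (e_connected x y).
move: lw0; have [w pw uw _] := shortenP pw0 => lw.
have lt_wT : size w < #|T|.
  by have := max_card (mem (x :: w)); rewrite (card_uniqP uw).
have ha : has a (iota 0 #|T|).
  apply/hasP; exists (size w); first by rewrite mem_iota.
  by apply/has_walkP; exists w.
have := nth_find 0 ha; rewrite nth_iota //.
by move: ha; rewrite has_find size_iota.
Qed.

Lemma dist_eq0 x y : (dist e x y == 0) = (x == y).
Proof.
apply/eqP/eqP => [d0|->]; last exact: dist_xx.
by have [w [/eqP + _ <-]] := dist_walk x y; rewrite d0 => /nilP->.
Qed.

Lemma dist_edge x y z : e y z -> dist e x z <= (dist e x y).+1.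
Proof.
move=> yz; have [w [<- pw lw]] := dist_walk x y.
have pz : path e x (rcons w z) by rewrite rcons_path pw lw.
by have := dist_leq pz; rewrite last_rcons size_rcons.
Qed.

Lemma dist_pred x z i :
  dist e x z = i.+1 -> exists2 y, e y z & dist e x y = i.
Proof.
move=> dxz; have [w []] := dist_walk x z; rewrite dxz.
case/lastP: w => // w z'; rewrite size_rcons last_rcons => -[sw] + ez.
rewrite {z'}ez rcons_path => /andP[pw ez]; exists (last x w) => //.
apply/eqP; rewrite eqn_leq -{1}sw dist_leq //= -ltnS -dxz.
exact: dist_edge.
Qed.

Lemma exists_dist i :
  0 < #|T| -> i <= diameter e -> exists x y, dist e x y = i.
Proof.
case/card_gt0P=> x0 _ iD.
have [x [y dxy]] : exists x y, dist e x y = diameter e.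
  have T_gt0 : 0 < #|T| by apply/card_gt0P; exists x0.
  rewrite /diameter.
  have [x ->] := @bigop.eq_bigmax _ (fun x => \max_y dist e x y) T_gt0.
  by have [y ->] := @bigop.eq_bigmax _ (dist e x) T_gt0; exists x, y.
exists x; move: (diameter e) iD y dxy => d; elim: d => [|d IHd].
  by rewrite leqn0 => /eqP-> y; exists y.
rewrite leq_eqVlt => /predU1P[->|iD] y; first by exists y.
by case/dist_pred=> z _ /(IHd iD).
Qed.

Hypothesis e_sym : symmetric e.

Lemma dist_sym x y : dist e x y = dist e y x.
Proof.
suff le_d x' y' : dist e x' y' <= dist e y' x'.
  by apply/eqP; rewrite eqn_leq !le_d.
move: x' y' => {}x {}y; have [w [<- pw lw]] := dist_walk y x.
have := @dist_leq x (rev (belast y w)).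
rewrite size_rev size_belast -{1 2}lw rev_path.
rewrite (eq_path (e' := e)); last by move=> ? ?; rewrite e_sym.
move/(_ pw); case: w pw lw => [|z w] /= _ lw; first by rewrite lw.
by rewrite rev_cons last_rcons lw.
Qed.

Hypothesis e_irr : irreflexive e.

Lemma dist_eq1 x y : (dist e x y == 1) = e x y.
Proof.
apply/eqP/idP => [/dist_pred[z zy /eqP]|xy].
  by rewrite dist_eq0 => /eqP->.
have: dist e x y <= 1 by have := dist_edge x xy; rewrite dist_xx.
case: (posnP (dist e x y)) => [/eqP|d_gt0 d_le1]; last first.
  by apply/eqP; rewrite eqn_leq d_le1.
by rewrite dist_eq0 => /eqP xy'; rewrite xy' e_irr in xy.
Qed.

Lemma dist_common_neighbour x y z :
  e x y -> e x z -> y != z -> ~~ e y z -> dist e y z = 2.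
Proof.
move=> xy xz yz nyz; apply/eqP; rewrite eqn_leq.
have/eqP dyx : dist e y x == 1 by rewrite dist_eq1 e_sym.
have := dist_edge y xz; rewrite dyx => -> /=; move: yz nyz; rewrite -dist_eq0 -dist_eq1.
by case: (dist e y z) => [|[]].
Qed.

End Distance.

(** * Cosine sequences of a distance-regular graph *)

Section Cosines.
Set Implicit Arguments.
Unset Strict Implicit.
Local Open Scope ring_scope.
Variables (R : realFieldType) (T : finType) (e : rel T).
Implicit Types (x y z : T) (w : nat -> R) (t : R).

(** The sequence of cosines of an eigenvalue [t]: up to scaling,
    [w (dist e x y)] is the (x, y) entry of the projection onto the eigenspace
    of [t]. *)
Definition cosine_sequence t w : Prop :=
  w 0%N = 1 /\
  forall x y, \sum_(z | e x z) w (dist e y z) = t * w (dist e y x).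

Lemma sum_pred1 x (f : T -> R) : \sum_z (z == x)%:R * f z = f x.
Proof.
rewrite (bigD1 x) //= eqxx mul1r big1 ?addr0 // => z /negPf->.
by rewrite mul0r.
Qed.

Lemma sum_bool (P : pred T) (f : T -> R) :
  \sum_z (P z)%:R * f z = \sum_(z | P z) f z.
Proof.
rewrite [RHS]big_mkcond; apply: eq_bigr => z _.
by case: (P z); rewrite ?mul1r ?mul0r.
Qed.

Lemma sum_indicator (A : {set T}) (P : pred T) :
  \sum_(z in A) (P z)%:R = #|[set z in A | P z]|%:R :> R.
Proof.
rewrite -natr_sum; congr _%:R.
rewrite -sum1_card big_mkcond [RHS]big_mkcond.
by apply: eq_bigr => z _; rewrite inE; case: (z \in A); case: (P z).
Qed.

(** Functions on the vertices replace row vectors indexed by their ranks. *)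
Lemma adjacency_eigenvector t :
    symmetric e -> eigenvalue (adjacency_mx R e) t ->
  exists2 v : T -> R, exists x, v x != 0
    & forall y, \sum_(z | e y z) v z = t * v y.
Proof.
move=> e_sym /eigenvalueP[u uA u_neq0]; exists (fun x => u 0 (enum_rank x)).
  have /rV0Pn[i ui] := u_neq0.
  by exists (enum_val i); rewrite enum_valK.
move=> y; have /matrixP/(_ 0 (enum_rank y)) := uA; rewrite !mxE => <-.
rewrite -sum_bool [RHS](reindex _ (onW_bij _ (@enum_rank_bij T))) /=.
apply: eq_bigr => z _; by rewrite !mxE !enum_rankK e_sym mulrC.
Qed.

Variable p : nat -> nat -> nat -> nat.
Hypothesis e_dr : distance_regular e p.

Let e_sym : symmetric e. Proof. by case: e_dr => -[]. Qed.
Let e_irr : irreflexive e. Proof. by case: e_dr => -[]. Qed.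
Let e_conn : connected_graph e. Proof. by case: e_dr. Qed.

Local Notation D := (diameter e).

Lemma card_intersection x y i j :
    (i <= D)%N -> (j <= D)%N ->
  #|[set z | (dist e x z == i) && (dist e y z == j)]| = p (dist e x y) i j.
Proof. by case: e_dr => _ _ H iD jD; apply: H => //; apply: dist_le_diameter. Qed.

Lemma card_sphere x i : (i <= D)%N -> #|[set z | dist e x z == i]| = p 0 i i.
Proof.
move=> iD; rewrite -{1}(dist_xx e x) -(card_intersection x x) //.
by apply: eq_card => z; rewrite !inE andbb.
Qed.

(** Distance-regularity in the form used below: a sum over all vertices of a
    function of the distances to [x] and [y] depends on [dist e x y] alone. *)
Lemma sum_by_dist x y (f : nat -> nat -> R) :
  \sum_z f (dist e x z) (dist e y z) =
  \sum_(i < D.+1) \sum_(j < D.+1) (p (dist e x y) i j)%:R * f i j.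
Proof.
have dD u v : (dist e u v < D.+1)%N by rewrite ltnS dist_le_diameter.
rewrite pair_big (partition_big
  (fun z => (Ordinal (dD x z), Ordinal (dD y z))) predT) //=.
apply: eq_bigr => -[i j] _ /=; rewrite -card_intersection ?leq_ord //.
rewrite mulr_natl -sumr_const; apply: eq_big => z.
  by rewrite inE xpair_eqE -!val_eqE.
by rewrite xpair_eqE -!val_eqE => /andP[/eqP/= -> /eqP/= ->].
Qed.

Definition neighbour_sum (f : nat -> R) (h : nat) : R :=
  \sum_(i < D.+1) \sum_(j < D.+1) (p h i j)%:R * ((i == 1%N :> nat)%:R * f j).

Lemma sum_neighbours_by_dist (f : nat -> R) x y :
  \sum_(z | e x z) f (dist e y z) = neighbour_sum f (dist e x y).
Proof.
apply: (etrans _ (sum_by_dist x y (fun i j => (i == 1%N)%:R * f j))).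
by rewrite -sum_bool; apply: eq_bigr => z _; rewrite dist_eq1.
Qed.

(** A vertex at distance [i] from [y] with [i < D] has neighbours at distance
    [i.+1], so the eigenvalue equation determines [w' i.+1] from the earlier
    values. *)
Lemma radial_eigenfunction_uniq t w w' :
    cosine_sequence t w ->
    (forall x y, \sum_(z | e x z) w' (dist e y z) = t * w' (dist e y x)) ->
  forall x y, w' (dist e x y) = w' 0%N * w (dist e x y).
Proof.
move=> [w0 Hw] Hw' x y; have := dist_le_diameter e x y.
have T_gt0 : (0 < #|T|)%N by apply/card_gt0P; exists x.
pose f i := w' i - w' 0%N * w i.
suff f0 i : (i <= D)%N -> f i = 0 by move=> /f0/eqP; rewrite subr_eq0 => /eqP.
have Hf a b : \sum_(z | e a z) f (dist e b z) = t * f (dist e b a).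
  by rewrite sumrB -mulr_sumr Hw Hw' /f; ring.
elim/ltn_ind: i => -[|i] IHi iD; first by rewrite /f w0 mulr1 subrr.
have [b [c dbc]] := exists_dist e_conn T_gt0 iD.
have [a ac dba] := dist_pred e_conn dbc.
have := Hf a b; rewrite dba IHi ?(ltnW iD) // mulr0.
have fz z : e a z -> f (dist e b z) = (dist e b z == i.+1)%:R * f i.+1.
  move=> az; have := dist_edge e_conn b az; rewrite dba.
  have [-> _|d_neq] := eqVneq; first by rewrite mul1r.
  rewrite leq_eqVlt (negPf d_neq) => /= dlt; rewrite mul0r IHi //.
  by rewrite (leq_trans _ iD) // ltnW.
rewrite (eq_bigr _ fz) -mulr_suml => /eqP; rewrite mulf_eq0 => /orP[|/eqP//].
rewrite psumr_eq0 ?/= => [|z _]; last exact: ler0n.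
move/allP/(_ c (mem_index_enum _)) => /=; rewrite ac dbc eqxx /=.
by rewrite oner_eq0.
Qed.

(** Average an eigenvector over the spheres around a vertex [x] where it does
    not vanish.  Averaging commutes with the adjacency operator because the
    number of edges from a vertex to a sphere depends only on distances. *)
Lemma cosine_sequence_exists t :
  eigenvalue (adjacency_mx R e) t -> exists w, cosine_sequence t w.
Proof.
move=> /(adjacency_eigenvector e_sym)[v [x vx] Hv].
pose K i := #|[set z | dist e x z == i]|.
pose V i := \sum_(z | dist e x z == i) v z.
have T_gt0 : (0 < #|T|)%N by apply/card_gt0P; exists x.
have K_gt0 i : (i <= D)%N -> (0 < K i)%N.
  move=> iD; have [b [c dbc]] := exists_dist e_conn T_gt0 iD.
  rewrite /K card_sphere // -(card_sphere b) //.
  by apply/card_gt0P; exists c; rewrite inE dbc.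
have K_neq0 i : (i <= D)%N -> (K i)%:R != 0 :> R.
  by move=> iD; rewrite pnatr_eq0 -lt0n K_gt0.
pose w i := V i / ((K i)%:R * v x).
have w_average (g : nat -> R) :
    v x * \sum_z g (dist e x z) * w (dist e x z) = \sum_z g (dist e x z) * v z.
  have by_sphere (f : T -> R) :
      \sum_z f z = \sum_(j < D.+1) \sum_(z | dist e x z == j) f z.
    have dD z : (dist e x z < D.+1)%N by rewrite ltnS dist_le_diameter.
    by rewrite (partition_big (fun z => Ordinal (dD z)) predT).
  rewrite !by_sphere mulr_sumr; apply: eq_bigr => j _.
  transitivity (g j * V j); last first.
    by rewrite mulr_sumr; apply: eq_bigr => z /eqP->.
  rewrite (eq_bigr (fun _ => g j * w j)) => [|z /eqP-> //].
  rewrite sumr_const (_ : #|_| = K j); last by apply: eq_card => z; rewrite inE.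
  rewrite /w -mulr_natl; field.
  by rewrite vx K_neq0 // leq_ord.
exists w; split.
  rewrite /w /V (big_pred1 x) => [|z]; last by rewrite dist_eq0 // eq_sym.
  rewrite /K (_ : [set z | _] = [set x]) ?cards1 ?mul1r ?divff //.
  by apply/setP=> z; rewrite !inE dist_eq0 // eq_sym.
move=> a b; rewrite sum_neighbours_by_dist dist_sym //.
set i := dist e b a; have iD : (i <= D)%N by apply: dist_le_diameter.
(* [N j] counts the neighbours, in the sphere of radius [i] around [x], of a
vertex at distance [j] from [x]. *)
pose N := neighbour_sum (fun j => (j == i)%:R).
have neighbour_indicator z :
    \sum_(y | e z y) (dist e x y == i)%:R = N (dist e x z).
  by rewrite (sum_neighbours_by_dist (fun j => (j == i)%:R)) dist_sym.
apply: (mulfI (K_neq0 i iD)); apply: (mulfI vx).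
transitivity (v x * \sum_z N (dist e x z) * w (dist e x z)).
  congr (_ * _); transitivity
    (\sum_(y | dist e x y == i) \sum_(z | e y z) w (dist e x z)).
    rewrite (eq_bigr (fun _ => neighbour_sum w i)) => [|y /eqP <-]; last first.
      by rewrite sum_neighbours_by_dist dist_sym.
    rewrite sumr_const mulr_natl; congr (_ *+ _).
    by apply: eq_card => z; rewrite inE.
  rewrite (exchange_big_dep predT) //=; apply: eq_bigr => z _.
  rewrite -neighbour_indicator mulr_suml [LHS]big_mkcond [RHS]big_mkcond /=.
  apply: eq_bigr => y _; rewrite (e_sym y) andbC.
  by case: (e z y) => //=; case: eqP; rewrite ?mul1r ?mul0r.
rewrite w_average.
transitivity (\sum_(y | dist e x y == i) t * v y); last first.
  rewrite -mulr_sumr -/(V i) /w; field.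
  by rewrite vx K_neq0.
rewrite -(eq_bigr _ (fun y _ => Hv y)) (exchange_big_dep predT) //=.
apply: eq_bigr => z _.
rewrite -neighbour_indicator mulr_suml [LHS]big_mkcond [RHS]big_mkcond /=.
apply: eq_bigr => y _; rewrite (e_sym y) andbC.
by case: (e z y) => //=; case: eqP; rewrite ?mul1r ?mul0r.
Qed.

(** The matrix [w (dist e x y)] is a positive multiple of its own square: each
    row of the square is again a radial eigenfunction, hence a multiple of the
    cosine sequence by [radial_eigenfunction_uniq].  This replaces the spectral
    theorem: it makes the matrix positive semidefinite, with isotropic vectors
    in its kernel. *)
Lemma cosine_gram t w :
    cosine_sequence t w ->
  exists2 c : R, 0 < c
    & forall x y, \sum_z w (dist e x z) * w (dist e y z) = c * w (dist e x y).
Proof.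
move=> w_cos; have [w0 Hw] := w_cos.
pose g h : R := \sum_(i < D.+1) \sum_(j < D.+1) (p h i j)%:R * (w i * w j).
have gE a b : \sum_z w (dist e a z) * w (dist e b z) = g (dist e a b).
  exact: (sum_by_dist a b (fun i j => w i * w j)).
have [T0|/card_gt0P[x _]] := posnP #|T|.
  by exists 1 => // x; have := fintype0 (x : T) T0.
exists (g 0%N) => [|a b].
  (* The diagonal entry of the square contains the summand [w 0 ^+ 2 = 1]. *)
  rewrite -(dist_xx e x) -gE (bigD1 x) //= dist_xx w0 mulr1.
  by rewrite ltr_wpDr // sumr_ge0 // => z _; rewrite -expr2 sqr_ge0.
rewrite gE; apply: (radial_eigenfunction_uniq w_cos) => {}a {}b.
under eq_bigr do rewrite -gE.
rewrite exchange_big /= -gE mulr_sumr; apply: eq_bigr => z _.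
rewrite -mulr_sumr mulrCA; congr (_ * _).
by under eq_bigr do rewrite dist_sym //; rewrite Hw dist_sym.
Qed.

Lemma cosine_form_sum_sqr t w :
    cosine_sequence t w -> exists2 c : R, 0 < c & forall f : T -> R,
  \sum_z (\sum_x f x * w (dist e x z)) ^+ 2 =
  c * \sum_x \sum_y f x * f y * w (dist e x y).
Proof.
move=> /cosine_gram[c c_gt0 wE]; exists c => // f.
transitivity (\sum_z \sum_x \sum_y
    f x * f y * (w (dist e x z) * w (dist e y z))).
  apply: eq_bigr => z _; rewrite expr2 mulr_suml; apply: eq_bigr => x _.
  by rewrite mulr_sumr; apply: eq_bigr => y _; rewrite mulrACA.
rewrite exchange_big mulr_sumr; apply: eq_bigr => x _.
rewrite exchange_big mulr_sumr; apply: eq_bigr => y _ /=.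
by rewrite -mulr_sumr wE mulrCA.
Qed.

Lemma cosine_form_ge0 t w (f : T -> R) :
  cosine_sequence t w -> 0 <= \sum_x \sum_y f x * f y * w (dist e x y).
Proof.
move=> /cosine_form_sum_sqr[c c_gt0 /(_ f) fE].
by rewrite -(pmulr_rge0 _ c_gt0) -fE sumr_ge0 // => z _; apply: sqr_ge0.
Qed.

Lemma cosine_form_eq0 t w (f : T -> R) :
    cosine_sequence t w -> \sum_x \sum_y f x * f y * w (dist e x y) = 0 ->
  forall z, \sum_x f x * w (dist e x z) = 0.
Proof.
move=> /cosine_form_sum_sqr[c c_gt0 /(_ f) fE] f0 z; apply/eqP.
move/eqP: fE; rewrite f0 mulr0 psumr_eq0 => [|y _]; last exact: sqr_ge0.
by move=> /allP/(_ z (mem_index_enum _)); rewrite sqrf_eq0.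
Qed.

Lemma card_neighbours x : (1 <= D)%N -> #|[set y | e x y]| = valency p.
Proof.
move=> D1; rewrite /valency /b_ -(card_sphere x D1).
by apply: eq_card => y; rewrite !inE dist_eq1.
Qed.

Lemma exists_neighbour x : (1 <= D)%N -> (0 < valency p)%N -> exists y, e x y.
Proof.
move=> D1; rewrite -(card_neighbours x) // => /card_gt0P[y].
by rewrite inE; exists y.
Qed.

Lemma card_common_neighbours_edge x y : (1 <= D)%N -> e x y ->
  #|[set z | e x z && e y z]| = a_ p 1.
Proof.
move=> D1; rewrite -dist_eq1 // => /eqP dxy.
have -> : a_ p 1 = p (dist e x y) 1 1 by rewrite dxy.
rewrite -card_intersection //.
by apply: eq_card => z; rewrite !inE !dist_eq1.
Qed.

Lemma card_nonadjacent_neighbours x y : (2 <= D)%N -> e x y ->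
  #|[set z | [&& e x z, z != y & ~~ e y z]]| = b_ p 1.
Proof.
move=> D2 xy; have /eqP dxy : dist e x y == 1%N by rewrite dist_eq1.
have -> : b_ p 1 = p (dist e x y) 1 2 by rewrite dxy.
rewrite -card_intersection // 1?ltnW //.
apply: eq_card => z; rewrite !inE dist_eq1 //; have [xz /=|//] := boolP (e x z).
apply/andP/eqP => [[nzy nyz]|dyz].
  by apply: (dist_common_neighbour _ _ _ xy) => //; rewrite eq_sym.
by rewrite eq_sym -(dist_eq0 e_conn) -(dist_eq1 e_conn) // dyz.
Qed.

Lemma card_common_neighbours_dist2 x y : (2 <= D)%N -> dist e x y = 2 ->
  #|[set z | e x z && e y z]| = c_ p 2.
Proof.
move=> D2 dxy.
have -> : c_ p 2 = p (dist e x y) 1 1 by rewrite dxy.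
rewrite -card_intersection // 1?ltnW //.
by apply: eq_card => z; rewrite !inE !dist_eq1.
Qed.

Lemma valency_split x : (2 <= D)%N -> (0 < valency p)%N ->
  valency p = (1 + a_ p 1 + b_ p 1)%N.
Proof.
move=> D2 k_gt0; have D1 := ltnW D2.
have [y xy] := exists_neighbour x D1 k_gt0.
rewrite -(card_neighbours x) // -(card_common_neighbours_edge D1 xy)
  -(card_nonadjacent_neighbours D2 xy) -addnA.
rewrite (cardsD1 y) inE xy; congr (_ + _)%N.
rewrite -(cardsID [set z | e y z]); congr (_ + _)%N; apply: eq_card => z;
  rewrite !inE.
  by have [->|] := eqVneq z y; rewrite ?e_irr ?andbF.
by rewrite andbC andbCA andbA.
Qed.

Lemma cosine_1 t w : (1 <= D)%N -> (0 < #|T|)%N -> cosine_sequence t w ->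
  (valency p)%:R * w 1%N = t.
Proof.
move=> D1 /card_gt0P[x _] [w0 /(_ x x)]; rewrite dist_xx w0 mulr1 => <-.
rewrite (eq_bigr (fun _ => w 1%N)) => [|z].
  rewrite sumr_const mulr_natl -(card_neighbours x) //.
  by congr (_ *+ _); apply: eq_card => z; rewrite inE.
by rewrite -dist_eq1 // => /eqP->.
Qed.

Lemma cosine_2 t w : (2 <= D)%N -> (0 < valency p)%N -> (0 < #|T|)%N ->
    cosine_sequence t w ->
  1 + (a_ p 1)%:R * w 1%N + (b_ p 1)%:R * w 2%N = t * w 1%N.
Proof.
move=> D2 k_gt0 /card_gt0P[x _] [w0 Hw]; have D1 := ltnW D2.
have [y xy] := exists_neighbour x D1 k_gt0.
have /eqP dyx : dist e y x == 1%N by rewrite dist_eq1 // e_sym.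
have := Hw x y; rewrite dyx => <-.
rewrite (bigD1 y) //= dist_xx w0 -addrA; congr (_ + _).
rewrite (bigID (e y)) /=; congr (_ + _).
  rewrite -(card_common_neighbours_edge D1 xy) mulr_natl.
  rewrite (eq_bigr (fun _ => w 1%N)) => [|z /andP[_]].
    rewrite sumr_const; congr (_ *+ _); apply: eq_card => z; rewrite !inE.
    rewrite [RHS]unfold_in; have [->|] := eqVneq z y;
      by rewrite ?e_irr ?andbF ?andbT.
  by rewrite -dist_eq1 // => /eqP->.
rewrite -(card_nonadjacent_neighbours D2 xy) mulr_natl.
rewrite (eq_bigr (fun _ => w 2%N)) => [|z /andP[/andP[xz nzy] nyz]].
  by rewrite sumr_const; congr (_ *+ _); apply: eq_card => z;
    rewrite inE [RHS]unfold_in andbA.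
by rewrite (dist_common_neighbour _ _ _ xy) // eq_sym.
Qed.

End Cosines.

(** * Partial geometries *)

Section PartialGeometry.
Set Implicit Arguments.
Unset Strict Implicit.
Variables V Q : finType.
Implicit Types (X S : {set V}) (L : Q -> {set V}) (v w x y z : V) (l : Q).

Definition collinear L v w : bool := [exists l, (v \in L l) && (w \in L l)].

Definition partial_linear L : Prop := forall v w l l', v != w ->
  v \in L l -> w \in L l -> v \in L l' -> w \in L l' -> l = l'.

(** A partial geometry pg(r - 1, m - 1, a) with point set [X]: [m] is the number
    of lines on a point, [r] the number of points on a line, and [a] the number
    of points of a line collinear with a given point off that line.  The point
    set is a subset so that it can be the neighbourhood of a vertex. *)
Record partial_geometry X L (m r a : nat) : Prop := PartialGeometry {
  pg_sub : forall l, L l \subset X;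
  pg_line : forall l, #|L l| = r;
  pg_point : forall v, v \in X -> #|[set l | v \in L l]| = m;
  pg_join : partial_linear L;
  pg_antiflag : forall v l, v \in X -> v \notin L l ->
    #|[set w in L l | collinear L v w]| = a }.

Lemma collinear_sym L : symmetric (collinear L).
Proof. by move=> v w; apply: eq_existsb => l; apply: andbC. Qed.

Lemma collinearP L v w :
  reflect (exists l, v \in L l /\ w \in L l) (collinear L v w).
Proof. by apply: (iffP existsP) => -[l /andP vwl]; exists l. Qed.

Lemma collinear_nat L v w : partial_linear L -> v != w ->
  (collinear L v w : nat) = \sum_(l | v \in L l) (w \in L l).
Proof.
move=> L_lin nvw.
have [/collinearP[l [vl wl]]|/collinearP ncol] := boolP (collinear L v w).
  rewrite (bigD1 l) //= wl big1 ?addn0 // => l' /andP[vl' nll'].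
  case: (boolP (w \in L l')) => // wl'.
  by rewrite (L_lin _ _ _ _ nvw vl' wl' vl wl) eqxx in nll'.
by rewrite big1 // => l vl; apply/eqP; rewrite eqb0; apply/negP => wl;
  case: ncol; exists l.
Qed.

Lemma sum_nat_mem (A B : {set V}) :
  \sum_(v in A) (v \in B) = #|A :&: B|.
Proof.
rewrite -sum1_card [RHS]big_mkcond [LHS]big_mkcond; apply: eq_bigr => v _.
by rewrite inE; case: (v \in A); case: (v \in B).
Qed.

(** Two distinct collinear points have exactly one common line, so the points
    collinear with [v] can be counted line by line. *)
Lemma card_collinear L S v : partial_linear L ->
  #|[set w in S | (w != v) && collinear L v w]| =
  \sum_(l | v \in L l) #|(L l :&: S) :\ v|.
Proof.
move=> L_lin; rewrite -sum1_card big_mkcond /=.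
rewrite (eq_bigr (fun w => \sum_(l | v \in L l) (w \in (L l :&: S) :\ v))).
  rewrite exchange_big; apply: eq_bigr => l _ /=.
  by rewrite -sum1_card [RHS]big_mkcond; apply: eq_bigr => w _; case: (w \in _).
move=> w _; rewrite !inE; have [->|nwv] /= := eqVneq w v.
  by rewrite andbF big1 // => l _; rewrite !inE eqxx.
have [wS|nwS] := boolP (w \in S); last first.
  by rewrite big1 // => l _; rewrite !inE (negPf nwS) !andbF.
rewrite eq_sym in nwv; transitivity (collinear L v w : nat).
  by case: (collinear L v w).
rewrite collinear_nat //; apply: eq_bigr => l _.
by rewrite !inE eq_sym nwv wS andbT.
Qed.

Lemma card_collinear_line L v l0 : partial_linear L -> v \notin L l0 ->
  #|[set w in L l0 | collinear L v w]| = \sum_(l | v \in L l) #|L l :&: L l0|.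
Proof.
move=> L_lin nvl0.
transitivity #|[set w in L l0 | (w != v) && collinear L v w]|.
  by apply: eq_card => w; rewrite !inE; have [->|//] := eqVneq w v; rewrite (negPf nvl0).
rewrite card_collinear //; apply: eq_bigr => l _; apply: eq_card => w; rewrite !inE.
by have [->|//] := eqVneq w v; rewrite (negPf nvl0) andbF.
Qed.

Variables (X : {set V}) (L : Q -> {set V}) (m r a : nat).
Hypothesis pg : partial_geometry X L m r a.

Let L_lin : partial_linear L := pg_join pg.

Lemma pg_valency v : v \in X ->
  #|[set w in X | (w != v) && collinear L v w]| = m * r.-1.
Proof.
move=> vX; rewrite card_collinear // -(pg_point pg vX) -sum_nat_const.
rewrite (eq_bigl (fun l => l \in [set l | v \in L l])) => [|l]; last by rewrite inE.
apply: eq_bigr => l; rewrite inE => vl.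
rewrite (setIidPl (pg_sub pg l)) -(pg_line pg l).
by rewrite (cardsD1 v (L l)) vl.
Qed.

Lemma pg_common_neighbours v w : v \in X -> w \in X -> ~~ collinear L v w ->
  #|[set u in X | collinear L v u && collinear L w u]| = m * a.
Proof.
move=> vX wX nvw; pose S := [set u in X | collinear L w u].
transitivity #|[set u in S | (u != v) && collinear L v u]|.
  apply: eq_card => u; rewrite !inE; case: eqVneq => [->|_]; last first.
    by rewrite /= -andbA [X in _ && X]andbC.
  by rewrite [collinear L w v]collinear_sym (negPf nvw) !andbF.
rewrite card_collinear // -(pg_point pg vX) -sum_nat_const.
rewrite (eq_bigl (fun l => l \in [set l | v \in L l])) => [|l]; last by rewrite inE.
apply: eq_bigr => l; rewrite inE => vl; rewrite -(pg_antiflag pg (v := w) (l := l)) //.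
  apply: eq_card => u; rewrite !inE; have [->|_] /= := eqVneq u v.
    by rewrite [collinear L w v]collinear_sym (negPf nvw) andbF.
  by have [ul|//] := boolP (u \in L l); rewrite (subsetP (pg_sub pg l)).
by apply/negP => wl; case/collinearP: nvw; exists l.
Qed.

Lemma card_collinear_off S l0 w : w \in L l0 ->
  #|[set v in S :\: L l0 | collinear L w v]| =
  \sum_(l | (w \in L l) && (l != l0)) #|(L l :&: S) :\ w|.
Proof.
move=> wl0.
transitivity #|[set v in S :\: L l0 | (v != w) && collinear L w v]|.
  by apply: eq_card => v; rewrite !inE; have [->|//] := eqVneq v w; rewrite wl0.
rewrite card_collinear // (bigD1 l0) //= [X in X + _](_ : _ = 0) ?add0n.
  apply: eq_bigr => l /andP[wl nll0]; apply: eq_card => v; rewrite !inE.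
  have [//|nvw /=] := eqVneq v w; have [vl /=|//] := boolP (v \in L l).
  have [vl0|//] := boolP (v \in L l0).
  by rewrite (pg_join pg nvw vl wl vl0 wl0) eqxx in nll0.
apply/eqP; rewrite cards_eq0; apply/eqP/setP => v; rewrite !inE.
by case: (v \in L l0); rewrite ?andbF.
Qed.

Lemma card_lines_on_but_one l0 w : w \in L l0 ->
  #|[set l | (w \in L l) && (l != l0)]| = m.-1.
Proof.
move=> wl0; have wX := subsetP (pg_sub pg l0) _ wl0.
rewrite -(pg_point pg wX) (cardsD1 l0 [set l | w \in L l]) inE wl0 /=.
by apply: eq_card => l; rewrite !inE andbC.
Qed.

Lemma exchange_collinear (A B : {set V}) :
  \sum_(v in A) #|[set w in B | collinear L v w]| =
  \sum_(w in B) #|[set v in A | collinear L w v]|.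
Proof.
pose f v w := (collinear L v w : nat).
have cardE (C : {set V}) v :
    #|[set w in C | collinear L v w]| = \sum_(w in C) f v w.
  rewrite -sum1_card big_mkcond [RHS]big_mkcond; apply: eq_bigr => w _.
  by rewrite inE /f; case: (w \in C); case: (collinear _ _ _).
under eq_bigr do rewrite cardE; rewrite exchange_big.
by apply: eq_bigr => w _; rewrite cardE; apply: eq_bigr => v _; rewrite /f collinear_sym.
Qed.

(** Count the collinear pairs formed by a point of [L l0] and a point off it. *)
Lemma card_off_line l0 : (#|X| - r) * a = r * (m.-1 * r.-1).
Proof.
have lX := pg_sub pg l0.
have := exchange_collinear (X :\: L l0) (L l0).
rewrite (eq_bigr (fun _ => a)) => [|v]; last first.
  by rewrite inE => /andP[vl vX]; rewrite (pg_antiflag pg).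
rewrite sum_nat_const cardsDS // (pg_line pg) => ->.
rewrite (eq_bigr (fun _ => m.-1 * r.-1)) => [|w wl0].
  by rewrite sum_nat_const (pg_line pg).
rewrite card_collinear_off // -(card_lines_on_but_one wl0) -sum_nat_const.
apply: eq_big => [l|l /andP[wl _]]; first by rewrite inE.
rewrite (setIidPl (pg_sub pg l)) -(pg_line pg l).
by rewrite (cardsD1 w (L l)) wl.
Qed.

(** A set of points that looks like the point set of a subgeometry with the
    same numbers of lines on a point and of points collinear in an antiflag,
    but with only [a.+1] points on a line. *)
Definition subgeometry S : Prop :=
  [/\ S \subset X, #|S| = m * a.+1 &
      forall l, L l :&: S != set0 -> #|L l :&: S| = a.+1].

(** Fix a line [l] meeting [S] in [a.+1] points.  A point of [S] off [l] is
    collinear with at most [a] of those.  Summing over the [m.-1 * a.+1] points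
    of [S] off [l], and counting the same pairs from the points of [L l :&: S],
    each of which sees [m.-1 * a] points of [S] off [l], shows that the bound
    is attained by every point: all points of [l] collinear with it lie in
    [S]. *)
Lemma subgeometry_closed S v w l :
    subgeometry S -> v \in S -> L l :&: S != set0 -> v \notin L l ->
    w \in L l -> collinear L v w ->
  w \in S.
Proof.
move=> [SX cS lS] vS l0 nvl wl vw.
pose f u := #|[set w in L l :&: S | collinear L u w]|.
have fle u : u \in S :\: L l -> f u <= a ?= iff (f u == a).
  rewrite inE => /andP[ul uS]; apply/leqif_eq.
  rewrite -(pg_antiflag pg (subsetP SX _ uS) ul); apply: subset_leq_card.
  by apply/subsetP=> z; rewrite !inE => /andP[/andP[-> _] ->].
have fsum : \sum_(u in S :\: L l) f u = \sum_(u in S :\: L l) a.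
  rewrite exchange_collinear (eq_bigr (fun _ => m.-1 * a)) => [|u].
    rewrite !sum_nat_const (lS l l0) mulnCA mulnA; congr (_ * _).
    have := cardsID (L l) S; rewrite setIC (lS l l0) cS.
    by move/(canRL (addKn _)) => ->; rewrite -[X in _ - X]mul1n -mulnBl subn1.
  rewrite inE => /andP[ul uS]; rewrite card_collinear_off //.
  rewrite -(card_lines_on_but_one ul) -sum_nat_const.
  apply: eq_big => [l'|l' /andP[ul' _]]; first by rewrite inE.
  have ul'S : u \in L l' :&: S by rewrite inE ul'.
  have := lS l'; rewrite (cardsD1 u) ul'S => /(_ _)/eqP; rewrite eqSS => H.
  by apply/eqP/H/set0Pn; exists u.
have := (leqif_sum fle).2; rewrite fsum eqxx => /esym/forall_inP/(_ v).
rewrite inE nvl vS => /(_ isT)/eqP fv.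
have /subset_cardP : f v = #|[set w in L l | collinear L v w]|.
  by rewrite fv (pg_antiflag pg) // (subsetP SX).
have sub : [set w in L l :&: S | collinear L v w] \subset
           [set w in L l | collinear L v w].
  by apply/subsetP=> z; rewrite !inE => /andP[/andP[-> _] ->].
move=> /(_ sub)/(_ w); rewrite !inE wl vw /=.
by case: (w \in S).
Qed.

Lemma card_line_meet l l' v :
  v \in L l -> v \notin L l' -> #|L l' :&: L l| <= 1.
Proof.
move=> vl nvl'; rewrite leqNgt; apply/card_gt1P => -[u [w []]].
rewrite !inE => /andP[ul' ul] /andP[wl' wl] nuw.
by rewrite (pg_join pg nuw ul' wl' ul wl) vl in nvl'.
Qed.

Lemma exists_line_missing l0 w : w \in X -> w \notin L l0 -> a < m ->
  exists2 l, w \in L l & L l0 :&: L l = set0.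
Proof.
move=> wX wl0 a_lt_m; suff /existsP[l /andP[wl /eqP ll0]] :
    [exists l, (w \in L l) && (L l0 :&: L l == set0)] by exists l.
apply: contraLR a_lt_m; rewrite negb_exists -leqNgt => /forallP meets.
rewrite -(pg_antiflag pg wX wl0) -(pg_point pg wX) -sum1_card card_collinear_line //.
rewrite (eq_bigl (fun l => w \in L l)) => [|l]; last by rewrite inE.
apply: leq_sum => l wl; have := meets l; rewrite wl /=.
case/set0Pn=> u; rewrite inE => /andP[ul0 ul]; apply/card_gt0P; exists u.
by rewrite inE ul ul0.
Qed.

(** Take a line [l0] through [y] and two points [y1], [y2] of [l0] not collinear
    with [w]; they exist since [a.+1 < r].  Let [S1] and [S2] be subgeometries
    through [w], [y1] and through [w], [y2].  By closure each meets [l0] in the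
    [a] points collinear with [w] and in one more point, so [y1] is not in
    [S2].  On a second line [l1] through [w], [S1] contains the [a] points
    collinear with a common point [z] of [S1], [S2] and [l0], and also the [a]
    points collinear with [y1].  Points of the first kind lie in [S2], those of
    the second kind do not unless they are on [l0].  This is too many for a
    line with [a.+1] points in [S1]. *)
Lemma noncollinear_pair_not_covered y w :
    1 < a -> 0 < m -> (a < m) || (2 < a) -> a.+1 < r ->
    y \in X -> w \in X -> ~~ collinear L y w ->
  ~ (forall u v, u \in X -> v \in X -> ~~ collinear L u v ->
     exists S, [/\ subgeometry S, u \in S & v \in S]).
Proof.
move=> a_gt1 m_gt0 am ar yX wX nyw cover.
have [l0 yl0] : exists l, y \in L l.
  by move: m_gt0; rewrite -(pg_point pg yX) => /card_gt0P[l]; rewrite inE; exists l.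
have wl0 : w \notin L l0 by apply: contra nyw => wl0; apply/collinearP; exists l0.
have l0X := subsetP (pg_sub pg l0).
pose C := [set u in L l0 | collinear L w u].
have cC : #|C| = a by apply: (pg_antiflag pg).
have [y1 [y2 [+ + ny12]]] : exists y1 y2,
    [/\ y1 \in L l0 :\: C, y2 \in L l0 :\: C & y1 != y2].
  apply/card_gt1P; rewrite cardsDS; last by apply/subsetP=> u; rewrite inE => /andP[].
  by rewrite cC (pg_line pg) ltn_subRL addn1.
rewrite !inE ![_ && (_ \in _)]andbC !negb_and => /andP[y1l0 /=].
rewrite y1l0 /= => nwy1 /andP[y2l0]; rewrite y2l0 /= => nwy2.
have [S1 [S1sub wS1 y1S1]] := cover w y1 wX (l0X _ y1l0) nwy1.
have [S2 [S2sub wS2 y2S2]] := cover w y2 wX (l0X _ y2l0) nwy2.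
have meet u S : u \in S -> u \in L l0 -> L l0 :&: S != set0.
  by move=> uS ul0; apply/set0Pn; exists u; rewrite inE ul0.
(* By closure [S] contains [C], and [a.+1] points leave room for one more. *)
have l0S u S : subgeometry S -> w \in S -> u \in S -> u \in L l0 ->
    ~~ collinear L w u -> L l0 :&: S = u |: C.
  move=> Ssub wS uS ul0 nwu; apply/esym/eqP; have [_ _ lS] := Ssub.
  rewrite eqEcard (lS _ (meet u S uS ul0)) cardsU1 cC inE (negPf nwu) andbF leqnn.
  rewrite andbT; apply/subsetP=> z; rewrite !inE => /predU1P[->|/andP[zl0 wz]].
    by rewrite ul0.
  by rewrite zl0 (subgeometry_closed Ssub wS (meet u S uS ul0) wl0).
have y1S2 : y1 \notin S2.
  have /setP/(_ y1) := l0S y2 S2 S2sub wS2 y2S2 y2l0 nwy2.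
  by rewrite !inE y1l0 (negPf ny12) (negPf nwy1) /= => ->.
(* If [a < m] some line on [w] misses [l0]; otherwise [2 < a], and any line on
[w] will do, as it meets [l0] at most once. *)
have [l1 wl1 l01] : exists2 l1, w \in L l1 & #|L l0 :&: L l1| + a.+1 < a + a.
  have [a_lt_m|a_ge_m] := ltnP a m.
    have [l wl l0l] := exists_line_missing wX wl0 a_lt_m; exists l => //.
    by rewrite l0l cards0 add0n -addn1 ltn_add2l.
  have [l wl] : exists l, w \in L l.
    by move: m_gt0; rewrite -(pg_point pg wX) => /card_gt0P[l]; rewrite inE; exists l.
  exists l => //; have := card_line_meet wl wl0.
  by move: am; rewrite ltnNge a_ge_m /=; clear; lia.
have [z zC zl1] : exists2 z, z \in C & z \notin L l1.
  apply/subsetPn/negP => Cl1.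
  have: C \subset L l0 :&: L l1.
    by rewrite subsetI Cl1 andbT; apply/subsetP=> u; rewrite inE => /andP[].
  move/subset_leq_card; rewrite cC leqNgt => /negP; apply.
  exact: leq_ltn_trans (card_line_meet wl1 wl0) a_gt1.
have zl0 : z \in L l0 by move: zC; rewrite inE => /andP[].
have zS S : subgeometry S -> w \in S -> forall u, u \in S -> u \in L l0 ->
    ~~ collinear L w u -> z \in S.
  move=> Ssub wS u uS ul0 nwu; have /setP/(_ z) := l0S u S Ssub wS uS ul0 nwu.
  by rewrite in_setU1 zC orbT inE => /andP[].
have l1S S : w \in S -> L l1 :&: S != set0.
  by move=> wS; apply/set0Pn; exists w; rewrite inE wl1.
pose A u := [set t in L l1 | collinear L u t].
have y1l1 : y1 \notin L l1 by apply: contra nwy1 => y1l1; apply/collinearP; exists l1.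
have zX := l0X z zl0; have y1X := l0X y1 y1l0.
have sA u S : subgeometry S -> w \in S -> u \in S -> u \notin L l1 ->
    A u \subset L l1 :&: S.
  move=> Ssub wS uS ul1; apply/subsetP=> t; rewrite !inE => /andP[tl1 ut].
  by rewrite tl1 (subgeometry_closed Ssub uS (l1S S wS) ul1).
have zS1 := zS S1 S1sub wS1 y1 y1S1 y1l0 nwy1.
have zS2 := zS S2 S2sub wS2 y2 y2S2 y2l0 nwy2.
(* A point of [S2] off [l0] and collinear with [y1] would put [y1] into [S2] by
closure. *)
have AI : A z :&: A y1 \subset L l0 :&: L l1.
  apply/subsetP=> t /setIP[tz ty1].
  have /setIP[tl1 tS2] := subsetP (sA z S2 S2sub wS2 zS2 zl1) t tz.
  rewrite inE tl1 andbT; apply: contraR y1S2 => tl0.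
  apply: (subgeometry_closed S2sub tS2 (meet y2 S2 y2S2 y2l0) tl0 y1l0).
  by rewrite collinear_sym; move: ty1; rewrite inE => /andP[].
have AU : A z :|: A y1 \subset L l1 :&: S1 by rewrite subUset !sA.
have := subset_leq_card AU; have [_ _ ->] := S1sub; last exact: l1S.
have := subset_leq_card AI; have := cardsUI (A z) (A y1).
rewrite !(pg_antiflag pg) //; move: l01; clear; lia.
Qed.

End PartialGeometry.

(** * Block graphs as point graphs of partial geometries *)

Section BlockGraphs.
Set Implicit Arguments.
Unset Strict Implicit.
Local Open Scope nat_scope.

Section Transport.
Variables (V W Q : finType) (g : V -> W).
Hypothesis g_inj : injective g.
Variables (X : {set V}) (L : Q -> {set V}) (m r a : nat).

Lemma collinear_imset v w :
  collinear (fun l => g @: L l) (g v) (g w) = collinear L v w.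
Proof. by apply: eq_existsb => l; rewrite !mem_imset. Qed.

Lemma pg_imset : partial_geometry X L m r a ->
  partial_geometry (g @: X) (fun l => g @: L l) m r a.
Proof.
case=> sub line point join antiflag; split.
- by move=> l; apply: imsetS.
- by move=> l; rewrite card_imset.
- move=> _ /imsetP[v vX ->]; rewrite -(point v vX).
  by apply: eq_card => l; rewrite !inE mem_imset.
- move=> v w l l' nvw /imsetP[v' + vE] /imsetP[w' + wE].
  rewrite {v}vE {w}wE !mem_imset // in nvw *; apply: join.
  by apply: contraNneq nvw => ->.
move=> _ l /imsetP[v vX ->]; rewrite mem_imset // => nvl.
rewrite -(antiflag v l vX nvl) -(card_imset _ g_inj).
apply: eq_card => w; rewrite !inE; apply/andP/imsetP => [[/imsetP[u ul ->]]|[u]].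
  by rewrite collinear_imset => vu; exists u; rewrite // inE ul.
by rewrite inE => /andP[ul vu] ->; rewrite collinear_imset mem_imset.
Qed.

End Transport.

Lemma local_graph_embedding (T V : finType) (e : rel T) (x : T) (e' : rel V) :
    graph_iso (@local_graph T e x) e' ->
  exists g : V -> T, [/\ injective g, g @: [set: V] = [set y | e x y]
    & forall u v, e (g u) (g v) = e' u v].
Proof.
case=> f [h fK hK] ef; exists (fun v => val (h v)); split.
- by move=> u v /val_inj /(can_inj hK).
- apply/setP=> y; rewrite inE; apply/imsetP/idP => [[v _ ->]|xy].
    exact: (valP (h v)).
  by exists (f (Sub y xy)); rewrite ?inE // fK SubK.
by move=> u v; rewrite -{2}(hK u) -{2}(hK v) ef.
Qed.

Section OrthogonalArray.
Variables (m q : nat) (M : 'M['I_q]_(m, q ^ 2)).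
Hypothesis M_oa : orthogonal_array M.

(** The points of the geometry are the columns, and a line collects the columns
    with a prescribed entry in a prescribed row. *)
Definition OA_line (l : 'I_m * 'I_q) : {set 'I_(q ^ 2)} :=
  [set j | M l.1 j == l.2].

Lemma in_OA_line j l : (j \in OA_line l) = (M l.1 j == l.2).
Proof. by rewrite inE. Qed.

Lemma OA_block_graphE j1 j2 :
  OA_block_graph M j1 j2 = (j1 != j2) && collinear OA_line j1 j2.
Proof.
congr (_ && _); apply/existsP/existsP => [[i /eqP Mi]|[[i s]]].
  by exists (i, M i j2); rewrite !(inE, in_OA_line) /= Mi eqxx.
rewrite !(inE, in_OA_line) /= => /andP[/eqP M1 /eqP M2].
by exists i; rewrite M1 M2.
Qed.

Lemma OA_meet i1 i2 s t : i1 != i2 -> #|OA_line (i1, s) :&: OA_line (i2, t)| = 1.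
Proof.
by move=> n12; rewrite -[RHS](M_oa n12 s t);
  apply: eq_card => j; rewrite !(inE, in_OA_line).
Qed.

Lemma OA_partial_linear : partial_linear OA_line.
Proof.
move=> v w [i s] [i' s'] nvw vl wl vl' wl'; have [eqi|nii'] := eqVneq i i'.
  move: vl vl'; rewrite !(inE, in_OA_line) /= eqi => /eqP vs /eqP vs'.
  by rewrite -vs -vs'.
have /eqP/cards1P[u uE] := OA_meet s s' nii'; move: nvw.
have: v \in [set u] by rewrite -uE in_setI vl.
have: w \in [set u] by rewrite -uE in_setI wl.
by rewrite !(inE, in_OA_line) => /eqP-> /eqP->; rewrite eqxx.
Qed.

Lemma OA_point j : #|[set l | j \in OA_line l]| = m.
Proof.
have inj : injective (fun i : 'I_m => (i, M i j)) by move=> i i' [].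
rewrite -[RHS](card_ord m) -(card_imset _ inj).
apply: eq_card => -[i s]; rewrite !(inE, in_OA_line) /=.
apply/eqP/imsetP => [<-|[i' _ [-> ->]]] //.
by exists i.
Qed.

(** Off the line of row [i] and symbol [s], a column [v] meets, in each of the
    other [m.-1] rows, exactly one column of that line.  With at most one row
    lines need not have [q] columns, whence the assumption on [m]. *)
Lemma OA_partial_geometry : 1 < m ->
  partial_geometry [set: 'I_(q ^ 2)] OA_line m q m.-1.
Proof.
move=> m_gt1; split=> [l|[i s]|v _||v [i s] _].
- exact: subsetT.
- have [i' nii'] : exists i', i != i'.
    have : 0 < #|[set: 'I_m] :\ i|.
      have := cardsD1 i [set: 'I_m]; rewrite inE cardsT card_ord add1n.
      by move: m_gt1 #|_ :\ _| => + c mE; rewrite {1}mE.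
    by case/card_gt0P=> i'; rewrite !(inE, in_OA_line) andbT eq_sym; exists i'.
  rewrite -[RHS](card_ord q) -sum1_card -[RHS]sum1_card.
  rewrite (partition_big (M i') predT) //=; apply: eq_bigr => t _.
  rewrite sum1_card -[RHS](OA_meet s t nii').
  by apply: eq_card => j; rewrite [LHS]unfold_in in_setI !in_OA_line.
- exact: OA_point.
- exact: OA_partial_linear.
rewrite in_OA_line /= => nMi.
rewrite (card_collinear_line OA_partial_linear); last by rewrite in_OA_line.
rewrite (bigD1 (i, M i v)) /= ?in_OA_line //= [X in X + _](_ : _ = 0) ?add0n; last first.
  apply/eqP; rewrite cards_eq0; apply/eqP/setP => j; rewrite !(inE, in_OA_line) /=.
  by apply: contraNF nMi => /andP[/eqP<- /eqP<-].
rewrite (eq_bigr (fun _ => 1)) => [|[i' t]]; last first.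
  rewrite in_OA_line /= => /andP[/eqP<- ni]; apply: OA_meet.
  by apply: contraNneq ni => ->.
have := OA_point v; rewrite (cardsD1 (i, M i v)) !(inE, in_OA_line) /=.
rewrite eqxx => /(congr1 predn) <-.
rewrite sum1_card; apply: eq_card => l.
by rewrite !(inE, in_OA_line) [LHS]unfold_in inE andbC.
Qed.

End OrthogonalArray.

Section Steiner.
Variables (m q : nat) (B : {set {set 'I_q}}).
Hypothesis B_steiner : steiner_system m B.

(** The geometry is dual to the design: its points are the blocks, and the line
    of [s] collects the blocks through [s]. *)
Definition Steiner_line (s : 'I_q) : {set block B} := [set A : block B | s \in val A].

Lemma in_Steiner_line A s : (A \in Steiner_line s) = (s \in val A).
Proof. by rewrite inE. Qed.

Lemma Steiner_meet s t : s != t -> #|Steiner_line s :&: Steiner_line t| = 1.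
Proof.
move=> nst; have [_ /(_ s t nst) <-] := B_steiner.
rewrite -(card_imset _ val_inj); apply: eq_card => A; apply/imsetP/idP.
  by case=> C; rewrite !(inE, in_Steiner_line) => /andP[sC tC] ->; rewrite (valP C) sC.
rewrite inE => /and3P[AB sA tA].
by exists (Sub A AB); rewrite ?SubK // !(inE, in_Steiner_line) SubK sA.
Qed.

Lemma Steiner_partial_linear : partial_linear Steiner_line.
Proof.
move=> v w s s' nvw vl wl vl' wl'; apply: contraNeq nvw => nss'.
have /eqP/cards1P[u uE] := Steiner_meet nss'.
have: v \in [set u] by rewrite -uE in_setI vl.
have: w \in [set u] by rewrite -uE in_setI wl.
by rewrite !(inE, in_Steiner_line) => /eqP-> /eqP->.
Qed.

Lemma steiner_block_graphE (A C : block B) :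
  steiner_block_graph A C = (A != C) && collinear Steiner_line A C.
Proof.
rewrite /steiner_block_graph; have [//|nAC /=] := eqVneq A C.
apply/cards1P/collinearP => [[s sE]|[s [sA sC]]].
  exists s; have : s \in val A :&: val C by rewrite sE inE.
  by rewrite !(inE, in_Steiner_line) => /andP[].
exists s; apply/setP=> t; rewrite !(inE, in_Steiner_line); apply/andP/eqP => [[tA tC]|->].
  apply: contraNeq nAC => nts; apply/eqP.
  have /eqP/cards1P[u uE] := Steiner_meet nts.
  rewrite !in_Steiner_line in sA sC.
  have: A \in [set u] by rewrite -uE !(inE, in_Steiner_line) tA sA.
  have: C \in [set u] by rewrite -uE !(inE, in_Steiner_line) tC sC.
  by rewrite !(inE, in_Steiner_line) => /eqP-> /eqP->.
by move: sA sC; rewrite !(inE, in_Steiner_line).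
Qed.

(** Each of the other points [t] lies in exactly one block through [s], and each
    block through [s] contains [m.-1] of them. *)
Lemma Steiner_replication s : #|Steiner_line s| * m.-1 = q.-1.
Proof.
have [cB _] := B_steiner.
transitivity (\sum_(t | t != s) #|Steiner_line t :&: Steiner_line s|); last first.
  rewrite (eq_bigr (fun _ => 1)) => [|t nts]; last exact: Steiner_meet.
  rewrite sum1_card -[in RHS](card_ord q) -[RHS](cardC1 s).
  by apply: eq_card => t; rewrite !inE.
under eq_bigr do rewrite setIC -sum_nat_mem.
rewrite exchange_big /= -sum_nat_const; apply: eq_bigr => A.
rewrite in_Steiner_line => sA; rewrite -(cB _ (valP A)) (cardsD1 s (val A)) sA /=.
rewrite -sum1_card big_mkcond [RHS]big_mkcond; apply: eq_bigr => t _.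
by rewrite !(inE, in_Steiner_line); case: (t == s); case: (t \in val A).
Qed.

Lemma Steiner_block_size : 1 < q -> 1 < m.
Proof.
move=> q_gt1; pose s : 'I_q := Ordinal (ltnW q_gt1).
have := Steiner_replication s; have : 0 < q.-1 by rewrite -subn1 subn_gt0.
by move=> /prednK <-; case: (m) => [|[|n]] //=; rewrite muln0.
Qed.

Lemma Steiner_partial_geometry : 1 < q ->
  partial_geometry [set: block B] Steiner_line m (q.-1 %/ m.-1) m.
Proof.
move=> q_gt1; have m_gt1 := Steiner_block_size q_gt1; have [cB _] := B_steiner.
have point (A : block B) : #|[set l | A \in Steiner_line l]| = m.
  by rewrite -(cB _ (valP A)); apply: eq_card => s; rewrite !(inE, in_Steiner_line).
split=> [l|s|A _||A s _].
- exact: subsetT.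
- by rewrite -(Steiner_replication s) mulnK //; move: m_gt1; clear; lia.
- exact: point.
- exact: Steiner_partial_linear.
move=> nAs; rewrite (card_collinear_line Steiner_partial_linear) //.
rewrite (eq_bigr (fun _ => 1)) => [|t tA]; last first.
  by apply: Steiner_meet; apply: contraNneq nAs => <-.
rewrite sum1_card -[RHS](point A); apply: eq_card => t.
by rewrite inE.
Qed.

End Steiner.
End BlockGraphs.

Local Open Scope ring_scope.

(** * Tight graphs with a partial geometry at a vertex *)

(** Modulo [k = 1 + a1 + b1] and [a1 = m * (r - 1)], the tightness identity says
    that a combination, with positive coefficients, of the slacks of the two
    bounds vanishes.  Hence both bounds are attained. *)
Lemma tight_extremal (R : realFieldType) (k a1 b1 m r th1 thD : R) :
    k = 1 + a1 + b1 -> a1 = m * (r - 1) -> 1 < r -> 0 < b1 -> 0 <= a1 ->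
    0 < 1 + th1 -> (m - 1) * (1 + th1) <= b1 -> 0 <= k + r * thD ->
    (th1 + k / (a1 + 1)) * (thD + k / (a1 + 1)) = - (k * a1 * b1 / (a1 + 1) ^+ 2) ->
  (m - 1) * (1 + th1) = b1 /\ k + r * thD = 0.
Proof.
move=> kE a1_lines r_gt1 b1_gt0 a1_ge0 s_gt0 bound1 boundD tight.
have c_gt0 : 0 < a1 + 1 by lra.
have k_gt0 : 0 < k by lra.
have tightE : (th1 * (a1 + 1) + k) * (thD * (a1 + 1) + k) + k * a1 * b1 = 0.
  have c_neq0 : a1 + 1 != 0 by rewrite gt_eqF.
  transitivity ((a1 + 1) ^+ 2 * ((th1 + k / (a1 + 1)) * (thD + k / (a1 + 1))
    + k * a1 * b1 / (a1 + 1) ^+ 2)); first by field.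
  by rewrite tight addNr mulr0.
have sum0 : k * (r - 1) * (b1 - (m - 1) * (1 + th1))
    + (k + r * thD) * ((1 + a1) * (1 + th1) + b1) = 0.
  apply: (mulfI (_ : a1 + 1 != 0)); first by rewrite gt_eqF.
  by rewrite mulr0 -[RHS](mulr0 r) -tightE kE a1_lines; ring.
have P1 : 0 < k * (r - 1) by rewrite mulr_gt0 // subr_gt0.
have P2 : 0 < (1 + a1) * (1 + th1) + b1.
  by rewrite addr_gt0 // mulr_gt0 // addrC.
have T1 : 0 <= k * (r - 1) * (b1 - (m - 1) * (1 + th1)).
  by rewrite mulr_ge0 ?(ltW P1) // subr_ge0.
have T2 : 0 <= (k + r * thD) * ((1 + a1) * (1 + th1) + b1).
  by rewrite mulr_ge0 ?(ltW P2).
move/eqP: sum0; rewrite paddr_eq0 // mulf_eq0 (gt_eqF P1).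
rewrite [X in _ && X]mulf_eq0 (gt_eqF P2).
by rewrite orbF subr_eq0 => /andP[/eqP-> /eqP->].
Qed.

Section LocallyPartialGeometry.
Set Implicit Arguments.
Unset Strict Implicit.
Variables (R : realFieldType) (T : finType) (e : rel T).
Variable p : nat -> nat -> nat -> nat.
Hypothesis e_dr : distance_regular e p.
Hypothesis diam_ge3 : (3 <= diameter e)%N.
Hypothesis b1_gt0 : (0 < b_ p 1)%N.
Implicit Types (x y z : T) (t : R) (w : nat -> R).

Let e_sym : symmetric e. Proof. by case: e_dr => -[]. Qed.
Let e_irr : irreflexive e. Proof. by case: e_dr => -[]. Qed.
Let e_conn : connected_graph e. Proof. by case: e_dr. Qed.
Let D1 : (1 <= diameter e)%N. Proof. by rewrite (leq_trans _ diam_ge3). Qed.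
Let D2 : (2 <= diameter e)%N. Proof. by rewrite (leq_trans _ diam_ge3). Qed.

Local Notation k := (valency p).
Local Notation a1 := (a_ p 1).
Local Notation b1 := (b_ p 1).
Local Notation nbhd x := [set y | e x y].

Hypothesis k_gt0 : (0 < k)%N.

Let T_gt0 : (0 < #|T|)%N.
Proof.
rewrite lt0n; apply: contraTneq diam_ge3 => T0.
by rewrite /diameter big_pred0 // => x; have := fintype0 (x : T) T0.
Qed.

Let kE : k = (1 + a1 + b1)%N.
Proof. by have /card_gt0P[x _] := T_gt0; apply: (valency_split e_dr x). Qed.

(** Together with [cosine_1] this gives the cosines at distances 1 and 2. *)
Lemma cosine_step t w : cosine_sequence e t w ->
  b1%:R * (w 1%N - w 2%N) = (1 - w 1%N) * (1 + t).
Proof.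
move=> w_cos; have E1 := cosine_1 e_dr D1 T_gt0 w_cos.
have E2 := cosine_2 e_dr D2 k_gt0 T_gt0 w_cos.
have kR : k%:R = 1 + a1%:R + b1%:R :> R by rewrite kE !natrD.
move: E1 E2; rewrite kR => <- E2; nra.
Qed.

Definition is_clique (K : {set T}) : Prop :=
  forall y z, y \in K -> z \in K -> y != z -> e y z.

Lemma clique_form t w (K : {set T}) : cosine_sequence e t w -> is_clique K ->
  \sum_y \sum_z (y \in K)%:R * (z \in K)%:R * w (dist e y z) =
  #|K|%:R * (1 + (#|K|%:R - 1) * w 1%N).
Proof.
move=> [w0 _] cl.
transitivity (\sum_(y in K) (1 + (#|K|%:R - 1) * w 1%N)).
  rewrite [RHS]big_mkcond; apply: eq_bigr => y _.
  under eq_bigr do rewrite -mulrA.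
  rewrite -mulr_sumr sum_bool; have [yK|_] := boolP (y \in K); last by rewrite mul0r.
  rewrite mul1r (bigD1 y) //= dist_xx w0; congr (_ + _).
  rewrite (eq_bigr (fun _ => w 1%N)) => [|z /andP[zK nzy]].
    rewrite sumr_const -[w _ *+ _]mulr_natl; congr (_ * _).
    rewrite [in RHS](cardD1 y) yK natrD addrC addKr; congr _%:R.
    by apply: eq_card => z; rewrite !inE andbC.
  have /eqP-> // : dist e y z == 1%N.
  by rewrite dist_eq1 // cl // eq_sym.
by rewrite sumr_const mulr_natl.
Qed.

(** Delsarte's clique bound: the characteristic vector of [K] has nonnegative
    value under the form of the cosine matrix. *)
Lemma clique_bound t w (K : {set T}) :
    cosine_sequence e t w -> is_clique K -> (0 < #|K|)%N ->
  0 <= k%:R + (#|K|%:R - 1) * t.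
Proof.
move=> w_cos cl K_gt0.
have := cosine_form_ge0 e_dr (fun y => (y \in K)%:R) w_cos.
rewrite (clique_form w_cos cl) pmulr_rge0 ?ltr0n // => h.
rewrite -(cosine_1 e_dr D1 T_gt0 w_cos) mulrCA -[X in X + _]mulr1 -mulrDr.
by rewrite mulr_ge0.
Qed.

(** In case of equality in [clique_bound] the characteristic vector of [K] is
    isotropic, hence in the kernel of the cosine matrix. *)
Lemma tight_clique t w (K : {set T}) :
    cosine_sequence e t w -> is_clique K -> k%:R + (#|K|%:R - 1) * t = 0 ->
  forall z, \sum_(y in K) w (dist e y z) = 0.
Proof.
move=> w_cos cl kt z; rewrite -sum_bool.
apply: (cosine_form_eq0 e_dr w_cos (f := fun y => (y \in K)%:R)).
rewrite (clique_form w_cos cl); suff -> : 1 + (#|K|%:R - 1) * w 1%N = 0.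
  by rewrite mulr0.
have kR0 : k%:R != 0 :> R by rewrite pnatr_eq0 -lt0n.
apply: (mulfI kR0); rewrite mulr0 -kt -(cosine_1 e_dr D1 T_gt0 w_cos).
by ring.
Qed.

Variables (Q : finType) (x : T) (L : Q -> {set T}) (m r a : nat).
Hypothesis pg : partial_geometry (nbhd x) L m r a.
Hypothesis e_local : forall y z, e x y -> e x z ->
  e y z = (y != z) && collinear L y z.
Hypothesis m_gt1 : (1 < m)%N.
Hypothesis r_gt1 : (1 < r)%N.

Let m_gt0 : (0 < m)%N := ltnW m_gt1.

Lemma on_line_nbhd l y : y \in L l -> e x y.
Proof. by move/(subsetP (pg_sub pg l)); rewrite inE. Qed.

Lemma exists_line y : e x y -> exists l, y \in L l.
Proof.
move=> xy; have yX : y \in nbhd x by rewrite inE.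
by move: m_gt0; rewrite -(pg_point pg yX) => /card_gt0P[l]; rewrite inE; exists l.
Qed.

(** A neighbour of [x] is adjacent, inside the neighbourhood, to [r.-1] points on
    each of its [m] lines. *)
Lemma local_valency : a1 = (m * r.-1)%N.
Proof.
have [y xy] := exists_neighbour e_dr x D1 k_gt0.
rewrite -(card_common_neighbours_edge e_dr D1 xy) -(pg_valency pg (v := y)) ?inE //.
apply: eq_card => z; rewrite !inE; have [xz|//] /= := boolP (e x z).
by rewrite e_local // eq_sym.
Qed.

Lemma line_lt_valency : (r < k)%N.
Proof. by rewrite kE local_valency; nia. Qed.

Lemma off_line_count : ((k - r) * a = r * (m.-1 * r.-1))%N.
Proof.
have [y /exists_line[l _]] := exists_neighbour e_dr x D1 k_gt0.
by rewrite -(card_off_line pg l) (card_neighbours e_dr).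
Qed.

Lemma antiflag_lt_line : (a < r)%N.
Proof.
have := off_line_count; have := kE; rewrite local_valency.
by have := m_gt1; have := r_gt1; have := b1_gt0; nia.
Qed.

Lemma b1_line : r%:R * b1%:R = (k%:R - r%:R) * (r%:R - a%:R) :> R.
Proof.
have lt_rk := line_lt_valency; have lt_ar := antiflag_lt_line.
rewrite -!natrB ?(ltnW lt_rk) ?(ltnW lt_ar) // -!natrM; congr _%:R.
rewrite mulnBr off_line_count kE local_valency.
have := m_gt1; have := r_gt1; nia.
Qed.

Lemma sum_over_lines (f : T -> R) : (forall y, ~~ e x y -> f y = 0) ->
  \sum_l \sum_(y in L l) f y = m%:R * \sum_y f y.
Proof.
move=> f0; rewrite (exchange_big_dep predT) //= mulr_sumr; apply: eq_bigr => y _.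
have [xy|/f0->] := boolP (e x y); last by rewrite big1 ?mulr0.
rewrite sumr_const mulr_natl; congr (_ *+ _).
rewrite -(pg_point pg (v := y)) ?inE //.
by apply: eq_card => l; rewrite !inE.
Qed.

(** On the neighbourhood of [x] the cosine matrix is a combination of the
    identity, the all-one matrix and the Gram matrix of the line-point
    incidence.  The last two annihilate a function with zero line sums. *)
Lemma cosine_zero_line_sums w (f : T -> R) :
    w 0%N = 1 -> (forall y, ~~ e x y -> f y = 0) ->
    (forall l, \sum_(y in L l) f y = 0) ->
  \sum_y \sum_z f y * f z * w (dist e y z) =
  (1 - w 2%N - m%:R * (w 1%N - w 2%N)) * \sum_y f y ^+ 2.
Proof.
move=> w0 f0 fL; set c := 1 - _ - _.
have f_sum0 : \sum_y f y = 0.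
  apply: (mulfI (_ : m%:R != 0)); first by rewrite pnatr_eq0 -lt0n.
  by rewrite -sum_over_lines // big1 ?mulr0.
rewrite mulr_sumr; apply: eq_bigr => y _.
have [xy|/f0->] := boolP (e x y); last first.
  by rewrite expr0n mulr0 big1 // => z _; rewrite !mul0r.
have wE z : e x z -> w (dist e y z) = w 2%N + c * (z == y)%:R
    + (w 1%N - w 2%N) * \sum_(l | y \in L l) (z \in L l)%:R.
  move=> xz; have [->|nzy] := eqVneq z y.
    rewrite dist_xx w0 mulr1 (_ : \sum_(l | _) _ = m%:R) /c; first by ring.
    rewrite (eq_bigr (fun _ => 1)) => [|l -> //]; rewrite sumr_const.
    congr _%:R; rewrite -(pg_point pg (v := y)) ?inE //.
    by apply: eq_card => l; rewrite !inE.
  rewrite -natr_sum -(collinear_nat (pg_join pg)) 1?eq_sym // mulr0 addr0.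
  have [col|ncol] := boolP (collinear L y z).
    have /eqP-> : dist e y z == 1%N by rewrite dist_eq1 // e_local // eq_sym nzy.
    by rewrite mulr1; ring.
  have nyz : ~~ e y z by rewrite e_local // (negPf ncol) andbF.
  rewrite eq_sym in nzy.
  have -> : dist e y z = 2.
    exact: (dist_common_neighbour e_conn e_sym e_irr xy xz nzy nyz).
  by rewrite mulr0 addr0.
transitivity (\sum_z (f y * w 2%N * f z + c * f y * ((z == y)%:R * f z) +
   (w 1%N - w 2%N) * f y * \sum_(l | y \in L l) (z \in L l)%:R * f z)).
  apply: eq_bigr => z _; have [/wE->|/f0->] := boolP (e x z).
    by rewrite -mulr_suml; ring.
  by rewrite big1 ?mulr0 ?mul0r ?addr0 // => l _; rewrite mulr0.
rewrite !big_split /= -!mulr_sumr f_sum0 mulr0 add0r sum_pred1 exchange_big /=.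
rewrite big1 ?mulr0 ?addr0 => [|l _]; first by ring.
by rewrite sum_bool fL.
Qed.

(** The local graph has [- m] as an eigenvalue: [f], built from a vertex [v] and
    its neighbours, is an eigenvector with zero line sums.  Positive
    semidefiniteness of the cosine matrix at [f] is the claim. *)
Lemma local_eigenvalue_bound t w : cosine_sequence e t w -> t < k%:R ->
  (m%:R - 1) * (1 + t) <= b1%:R.
Proof.
move=> w_cos lt_tk; have [v xv] := exists_neighbour e_dr x D1 k_gt0; have [w0 _] := w_cos.
(* [f] takes three values, on [v], its neighbours and the rest; [s] is chosen to
make the sums over the lines through [v] and off [v] vanish. *)
pose s : R := r%:R * (r%:R - a%:R - 1).
pose f z : R := if e x z then r%:R * (e v z)%:R - s * (z == v)%:R - a%:R else 0.
have f0 z : ~~ e x z -> f z = 0 by rewrite /f => /negPf->.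
have fL l : \sum_(z in L l) f z = 0.
  rewrite (eq_bigr (fun z => r%:R * (e v z)%:R - s * (z == v)%:R - a%:R)); last first.
    by move=> z /on_line_nbhd xz; rewrite /f xz.
  rewrite !sumrB -!mulr_sumr !sum_indicator sumr_const (pg_line pg) -[a%:R *+ r]mulr_natl.
  rewrite [X in s * X](_ : _ = (v \in L l)%:R); last first.
    rewrite -sum_indicator -(sum_pred1 v (fun z => (z \in L l)%:R)) -sum_bool.
    by apply: eq_bigr => z _; rewrite mulrC.
  have [vl|nvl] := boolP (v \in L l).
    have -> : [set z in L l | e v z] = L l :\ v.
      apply/setP => z; rewrite !inE andbC.
      have [zl|_] := boolP (z \in L l); last by rewrite !andbF.
      rewrite !andbT e_local ?(on_line_nbhd zl) // eq_sym.
      by rewrite (_ : collinear L v z) ?andbT //; apply/collinearP; exists l.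
    have -> : #|L l :\ v|%:R = r%:R - 1 :> R.
      by rewrite -(pg_line pg l) (cardsD1 v (L l)) vl natrD addrC addKr.
    by rewrite /s /=; ring.
  have -> : [set z in L l | e v z] = [set z in L l | collinear L v z].
    apply/setP => z; rewrite !inE; have [zl|//] := boolP (z \in L l).
    rewrite e_local ?(on_line_nbhd zl) //.
    by have [vz|//] := eqVneq v z; rewrite vz zl in nvl.
  by rewrite (pg_antiflag pg) ?inE //=; ring.
have form_ge0 := cosine_form_ge0 e_dr f w_cos.
rewrite cosine_zero_line_sums // in form_ge0.
have f_gt0 : 0 < \sum_y f y ^+ 2.
  have [l vl] := exists_line xv.
  have [z zl nzv] : exists2 z, z \in L l & z != v.
    have : (0 < #|L l :\ v|)%N.
      by have := r_gt1; rewrite -(pg_line pg l) (cardsD1 v) vl.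
    by case/card_gt0P=> z /setD1P[nzv zl]; exists z.
  have xz := on_line_nbhd zl.
  rewrite (bigD1 z) //= ltr_wpDr ?sumr_ge0 // => [y _|]; first exact: sqr_ge0.
  rewrite exprn_even_gt0 //= /f xz e_local // (eq_sym v z) (negPf nzv).
  rewrite (_ : collinear L v z) /=; last by apply/collinearP; exists l.
  by rewrite mulr1 mulr0 subr0 subr_eq0 eqr_nat gtn_eqF // antiflag_lt_line.
rewrite pmulr_lge0 // in form_ge0.
have k0 : 0 < k%:R :> R by rewrite ltr0n.
have w1_lt1 : 0 < 1 - w 1%N.
  rewrite subr_gt0 -(ltr_pM2l k0) mulr1.
  by rewrite (cosine_1 e_dr D1 T_gt0 w_cos).
have b1_ge0 : 0 <= b1%:R :> R by apply: ler0n.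
have E := cosine_step w_cos.
have := mulr_ge0 b1_ge0 form_ge0.
have -> : b1%:R * (1 - w 2%N - m%:R * (w 1%N - w 2%N)) =
    (1 - w 1%N) * (b1%:R - (m%:R - 1) * (1 + t)).
  have -> : 1 - w 2%N - m%:R * (w 1%N - w 2%N) =
     (1 - w 1%N) + (w 1%N - w 2%N) * (1 - m%:R) by ring.
  by rewrite mulrDr [X in _ + X]mulrA E; ring.
by rewrite pmulr_rge0 // subr_ge0.
Qed.

(** Cliques of this size attain the clique bound when the graph is tight. *)
Definition line_clique l : {set T} := x |: L l.

Lemma card_line_clique l : #|line_clique l| = r.+1.
Proof.
rewrite cardsU1 (pg_line pg) (_ : x \notin L l) //.
by apply/negP => /on_line_nbhd; rewrite e_irr.
Qed.

Lemma line_clique_is_clique l : is_clique (line_clique l).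
Proof.
move=> y z; rewrite !inE => /predU1P[->|yl] /predU1P[->|zl]; rewrite ?eqxx //.
- by rewrite (on_line_nbhd zl).
- by rewrite e_sym (on_line_nbhd yl).
move=> nyz; rewrite e_local ?(on_line_nbhd yl) ?(on_line_nbhd zl) // nyz /=.
by apply/collinearP; exists l.
Qed.

Lemma line_bound t w : cosine_sequence e t w -> 0 <= k%:R + r%:R * t.
Proof.
move=> w_cos; have [y /exists_line[l _]] := exists_neighbour e_dr x D1 k_gt0.
have := clique_bound w_cos (@line_clique_is_clique l).
by rewrite card_line_clique -natr1 addrK; apply.
Qed.

(** The points of [L l], if one of them is adjacent to [z], are at distance 1 or
    2 from [z], and [x] is at distance 2.  As the cosines of the points of the
    clique with respect to [z] sum to zero, the number of points at distance 1
    is determined. *)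
Lemma line_meets_common_neighbours t w z l :
    cosine_sequence e t w -> k%:R + r%:R * t = 0 -> dist e x z = 2 ->
    L l :&: [set y | e x y && e z y] != set0 ->
  #|L l :&: [set y | e x y && e z y]| = a.+1.
Proof.
move=> w_cos tE dxz; set S := [set y | _] => /set0Pn[y0 /setIP[y0l]].
rewrite inE => /andP[xy0 zy0].
have w_lS : \sum_(y in line_clique l) w (dist e y z) = 0.
  apply: (tight_clique w_cos (@line_clique_is_clique l)).
  by rewrite card_line_clique -natr1 addrK.
have nxl : x \notin L l by apply/negP => /on_line_nbhd; rewrite e_irr.
have wE y : y \in L l ->
    w (dist e y z) = w 2%N + (w 1%N - w 2%N) * (y \in S)%:R.
  move=> yl; rewrite inE (on_line_nbhd yl) /=; have [zy|nzy] := boolP (e z y).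
    have /eqP-> : dist e y z == 1%N by rewrite dist_eq1 // e_sym.
    by rewrite mulr1; ring.
  rewrite mulr0 addr0.
  suff -> : dist e y z = 2 by [].
  have [eq_y0|ny] := eqVneq y y0; first by rewrite eq_y0 zy0 in nzy.
  apply: (dist_common_neighbour (x := y0) e_conn e_sym e_irr).
  - rewrite e_local ?(on_line_nbhd yl) // eq_sym ny.
    by apply/collinearP; exists l.
  - by rewrite e_sym.
  - apply/eqP => eq_yz; move: dxz; rewrite -eq_yz.
    by have /eqP-> : dist e x y == 1%N by rewrite dist_eq1 // (on_line_nbhd yl).
  by rewrite e_sym.
have wx : w (dist e x z) = w 2%N by rewrite dxz.
rewrite big_setU1 //= wx (eq_bigr _ wE) big_split /= sumr_const (pg_line pg) in w_lS.
rewrite -mulr_sumr sum_indicator in w_lS.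
set j := #|_| in w_lS.
have -> : #|L l :&: S| = j by apply: eq_card => y; rewrite !inE.
have E := cosine_step w_cos; have E1 := cosine_1 e_dr D1 T_gt0 w_cos.
have Eb := b1_line.
have kr : r%:R < k%:R :> R by rewrite ltr_nat line_lt_valency.
have r0 : 0 < r%:R :> R by rewrite ltr0n ltnW.
apply/eqP; rewrite -(eqr_nat R) -natr1.
move: (j%:R : R) w_lS => J w_lS.
set d := w 1%N - w 2%N in E w_lS.
have k0 : (k%:R : R) != 0 by rewrite pnatr_eq0 -lt0n.
have w1 : r%:R * w 1%N = -1.
  apply: (mulfI k0); rewrite mulrCA E1 mulrN1.
  by apply/eqP; rewrite -addr_eq0 addrC tE.
(* [J] is the number of points of [L l] adjacent to [z] and [d] the step of the
cosines from distance 1 to 2.  The zero cosine sum and [cosine_step] express [d]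
twice. *)
have dJ : r%:R * d * (J - r%:R - 1) = r%:R + 1.
  have w2E : w 2%N = w 1%N - d by rewrite /d; ring.
  have -> : r%:R * d * (J - r%:R - 1) =
      r%:R * (w 2%N + (w 2%N *+ r + d * J)) - (r%:R + 1) * (r%:R * w 1%N).
    by rewrite w2E -[(w 1%N - d) *+ r]mulr_natl; ring.
  by rewrite w_lS w1; ring.
have bd : r%:R * b1%:R * (r%:R * d) = (r%:R + 1) * (r%:R - k%:R).
  have -> : r%:R * b1%:R * (r%:R * d) = r%:R * r%:R * (b1%:R * d) by ring.
  have -> : k%:R = - (r%:R * t) by apply/eqP; rewrite -addr_eq0 tE.
  have -> : r%:R + 1 = r%:R - r%:R * w 1%N :> R by rewrite w1 opprK.
  by rewrite E; ring.
have kr0 : (k%:R - r%:R : R) != 0 by rewrite subr_eq0 gt_eqF.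
have r10 : (r%:R + 1 : R) != 0 by rewrite natr1 pnatr_eq0.
rewrite -subr_eq0 -(inj_eq (mulfI kr0)) -(inj_eq (mulfI r10)) !mulr0; apply/eqP.
transitivity (r%:R * b1%:R * (r%:R + 1) -
    (r%:R * b1%:R * (r%:R * d)) * (J - r%:R - 1)); last first.
  by rewrite -[_ * (J - _ - _)]mulrA dJ subrr.
by rewrite bd Eb; ring.
Qed.

Lemma common_neighbours_subgeometry t w z :
    cosine_sequence e t w -> k%:R + r%:R * t = 0 -> dist e x z = 2 ->
    c_ p 2 = (m * a.+1)%N ->
  subgeometry (nbhd x) L m a [set y | e x y && e z y].
Proof.
move=> w_cos tE dxz c2; split=> [||l].
- by apply/subsetP=> y; rewrite !inE => /andP[].
- by rewrite (card_common_neighbours_dist2 e_dr D2 dxz).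
exact: (line_meets_common_neighbours w_cos tE dxz).
Qed.

(** Of the [m * a.+1] common neighbours of [y1] and [y2] only [m * a] are
    adjacent to [x], so one different from [x] is at distance 2 from [x]. *)
Lemma noncollinear_in_common_neighbours y1 y2 :
    c_ p 2 = (m * a.+1)%N -> e x y1 -> e x y2 -> ~~ collinear L y1 y2 ->
  exists2 z, dist e x z = 2 & e z y1 /\ e z y2.
Proof.
move=> c2 xy1 xy2 ncol.
have ny12 : y1 != y2.
  apply: contraNneq ncol => <-; have [l y1l] := exists_line xy1.
  by apply/collinearP; exists l.
have dy12 : dist e y1 y2 = 2.
  apply: (dist_common_neighbour e_conn e_sym e_irr xy1 xy2 ny12).
  by rewrite e_local // (negPf ncol) andbF.
have cN := card_common_neighbours_dist2 e_dr D2 dy12; set N := [set z | _] in cN.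
have xN : x \in N by rewrite inE e_sym xy1 e_sym.
have cNx : (#|N :&: nbhd x| <= m * a)%N.
  have y1X : y1 \in nbhd x by rewrite inE.
  have y2X : y2 \in nbhd x by rewrite inE.
  rewrite -(pg_common_neighbours pg y1X y2X ncol); apply: subset_leq_card.
  apply/subsetP=> z; rewrite !inE => /andP[/andP[yz1 yz2] xz]; rewrite xz /=.
  move: yz1 yz2; rewrite (e_local xy1 xz) (e_local xy2 xz).
  by move=> /andP[_ ->] /andP[_ ->].
have /card_gt0P[z] : (0 < #|(N :\: nbhd x) :\ x|)%N.
  have := cardsD1 x (N :\: nbhd x); rewrite in_setD xN inE e_irr /=.
  have := cardsID (nbhd x) N; rewrite cN c2 mulnS; move: cNx m_gt1.
  move: (m * a)%N #|_ :&: _| #|_ :\: _| #|_ :\ _| => ? ? ? ?; clear; lia.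
rewrite !inE => /and4P[nzx nxz y1z y2z]; exists z; last by rewrite e_sym y1z e_sym.
apply: (dist_common_neighbour (x := y1) e_conn e_sym e_irr) => //.
  by rewrite e_sym.
by rewrite eq_sym.
Qed.

(** The bounds of [local_eigenvalue_bound] at [th1] and [line_bound] at [thD] are
    attained because of tightness.  The first equality is the formula for [m].
    By the second one, common neighbourhoods of [x] and vertices at distance 2
    meet lines in 0 or [a.+1] points.  If [c_ p 2 = m * a.+1], they are
    subgeometries that cover all noncollinear pairs, against
    [noncollinear_pair_not_covered]. *)
Theorem tight_locally_pg th1 thD :
    eigenvalue (adjacency_mx R e) th1 -> eigenvalue (adjacency_mx R e) thD ->
    th1 < k%:R -> 0 < 1 + th1 ->
    (th1 + k%:R / (a1%:R + 1)) * (thD + k%:R / (a1%:R + 1)) =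
      - (k%:R * a1%:R * b1%:R / (a1%:R + 1) ^+ 2) ->
  (m%:R - 1) * (1 + th1) = b1%:R /\
  ((1 < a)%N -> (a < m)%N || (2 < a)%N -> (a.+1 < r)%N ->
   c_ p 2 <> (m * a.+1)%N).
Proof.
move=> /(cosine_sequence_exists e_dr)[w1 w1_cos].
move=> /(cosine_sequence_exists e_dr)[wD wD_cos] th1_lt s_gt0 tight.
have [] := @tight_extremal R k%:R a1%:R b1%:R m%:R r%:R th1 thD.
- by rewrite kE !natrD.
- by rewrite local_valency natrM -subn1 natrB // ltnW.
- by rewrite ltr1n.
- by rewrite ltr0n.
- exact: ler0n.
- exact: s_gt0.
- exact: local_eigenvalue_bound w1_cos th1_lt.
- exact: line_bound wD_cos.
- exact: tight.
move=> E1 ED; split=> // a_gt1 am ar c2.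
have [v xv] := exists_neighbour e_dr x D1 k_gt0.
have [u] : exists u, u \in [set z | [&& e x z, z != v & ~~ e v z]].
  by apply/card_gt0P; rewrite (card_nonadjacent_neighbours e_dr D2 xv).
rewrite inE => /and3P[xu nuv]; rewrite e_local // eq_sym nuv /= => ncol.
have vX : v \in nbhd x by rewrite inE.
have uX : u \in nbhd x by rewrite inE.
apply: (noncollinear_pair_not_covered pg a_gt1 m_gt0 am ar vX uX ncol).
move=> y1 y2; rewrite !inE => xy1 xy2 ncol12.
have [z dxz [zy1 zy2]] := noncollinear_in_common_neighbours c2 xy1 xy2 ncol12.
exists [set y | e x y && e z y]; rewrite !inE xy1 xy2 zy1 zy2; split=> //.
exact: common_neighbours_subgeometry wD_cos ED dxz c2.
Qed.

End LocallyPartialGeometry.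

(** * Tight graphs are not locally disjoint unions of cliques *)

Section LocallyCliques.
Set Implicit Arguments.
Unset Strict Implicit.
Variables (R : realFieldType) (T : finType) (e : rel T).
Variable p : nat -> nat -> nat -> nat.
Hypothesis e_dr : distance_regular e p.
Hypothesis diam_ge3 : (3 <= diameter e)%N.
Hypothesis b1_gt0 : (0 < b_ p 1)%N.
Hypothesis k_gt0 : (0 < valency p)%N.

Local Notation k := (valency p).
Local Notation a1 := (a_ p 1).
Local Notation b1 := (b_ p 1).

Let e_sym : symmetric e. Proof. by case: e_dr => -[]. Qed.
Let e_irr : irreflexive e. Proof. by case: e_dr => -[]. Qed.
Let e_conn : connected_graph e. Proof. by case: e_dr. Qed.
Let D1 : (1 <= diameter e)%N. Proof. by rewrite (leq_trans _ diam_ge3). Qed.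
Let D2 : (2 <= diameter e)%N. Proof. by rewrite (leq_trans _ diam_ge3). Qed.

(** An edge attains the clique bound for [- k], so the cosines at its ends with
    respect to any vertex are opposite; their sign is a 2-colouring. *)
Lemma bipartite_of_eigenvalue_opp_valency (x0 : T) w :
  cosine_sequence e (- k%:R : R) w -> bipartite e.
Proof.
move=> w_cos; have [w0 _] := w_cos.
have alt u v : e u v -> w (dist e u x0) = - w (dist e v x0).
  move=> uv; have nuv : u != v by apply: contraTneq uv => ->; rewrite e_irr.
  have cl : is_clique e [set u; v].
    move=> y z; rewrite !inE => /orP[]/eqP-> /orP[]/eqP->; rewrite ?eqxx //.
    by rewrite e_sym.
  have := tight_clique e_dr diam_ge3 k_gt0 w_cos cl _ x0.
  rewrite cards2 nuv big_setU1 ?inE //= big_set1 => H; apply/eqP.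
  by rewrite -addr_eq0 H //; ring.
have neq0 i : forall v, dist e x0 v = i -> w (dist e v x0) != 0.
  elim: i => [|i IHi] v.
    by move/eqP; rewrite dist_eq0 // => /eqP<-; rewrite dist_xx w0 oner_eq0.
  by case/(dist_pred e_conn) => u uv /IHi; rewrite (alt u v uv) oppr_eq0.
exists (fun v => 0 < w (dist e v x0)) => u v uv.
rewrite (alt u v uv) oppr_gt0; have := neq0 _ v erefl.
by rewrite neq_lt; case: ltgtP.
Qed.

(** An edge on [x] and its common neighbours form a clique of size [a1.+2].  By
    the clique bound the second factor in the tightness identity is then
    nonnegative; the first is positive and the right-hand side is at most 0,
    so both sides vanish.  This forces [a1 = 0] and [thD = - k], and the graph
    is bipartite. *)
Lemma tight_not_locally_cliques (x : T) th1 thD :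
    eigenvalue (adjacency_mx R e) thD -> 0 < 1 + th1 ->
    (th1 + k%:R / (a1%:R + 1)) * (thD + k%:R / (a1%:R + 1)) =
      - (k%:R * a1%:R * b1%:R / (a1%:R + 1) ^+ 2) ->
    ~ bipartite e ->
  ~ (forall u v z, e x u -> e x v -> e x z -> e u v -> e u z -> v != z -> e v z).
Proof.
move=> /(cosine_sequence_exists e_dr)[w w_cos] s_gt0 tight nbip cl_x.
have kE : k = (1 + a1 + b1)%N by apply: (valency_split e_dr x).
have [u xu] := exists_neighbour e_dr x D1 k_gt0.
pose N := [set z | e x z && e u z].
have cl : is_clique e (x |: (u |: N)).
  move=> y z; rewrite !inE => /or3P[/eqP->|/eqP->|/andP[xy uy]]
    /or3P[/eqP->|/eqP->|/andP[xz uz]]; rewrite ?eqxx // => nyz.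
  - by rewrite e_sym.
  - by rewrite e_sym.
  - by rewrite e_sym.
  exact: (cl_x u).
have cK : #|x |: (u |: N)| = a1.+2.
  have nuN : u \notin N by rewrite inE e_irr andbF.
  have nxuN : x \notin u |: N.
    by rewrite !inE e_irr orbF; apply: contraTneq xu => <-; rewrite e_irr.
  by rewrite !cardsU1 nuN nxuN (card_common_neighbours_edge e_dr D1 xu).
have := clique_bound e_dr diam_ge3 w_cos cl.
rewrite cK => /(_ isT); rewrite -natr1 addrK -natr1 => bound.
have c_gt0 : 0 < a1%:R + 1 :> R by rewrite ltr_wpDl.
have kR : k%:R = 1 + a1%:R + b1%:R :> R by rewrite kE !natrD.
have k0 : 0 < k%:R :> R by rewrite ltr0n.
have b0 : 0 < b1%:R :> R by rewrite ltr0n.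
have a0 : 0 <= a1%:R :> R by rewrite ler0n.
have F1 : 0 < th1 + k%:R / (a1%:R + 1).
  have : 1 < k%:R / (a1%:R + 1) :> R by rewrite ltr_pdivlMr // mul1r kR; lra.
  by lra.
have F2 : 0 <= thD + k%:R / (a1%:R + 1).
  rewrite -(pmulr_rge0 _ c_gt0) mulrDr [X in _ + X]mulrC divfK ?gt_eqF //.
  by rewrite addrC.
have F3 : 0 <= k%:R * a1%:R * b1%:R / (a1%:R + 1) ^+ 2 :> R.
  by rewrite !mulr_ge0 ?invr_ge0 ?exprn_ge0 ?(ltW k0) ?(ltW b0) ?(ltW c_gt0).
have Z : (th1 + k%:R / (a1%:R + 1)) * (thD + k%:R / (a1%:R + 1)) = 0.
  apply/eqP; rewrite eq_le mulr_ge0 ?(ltW F1) // andbT tight.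
  by rewrite oppr_le0.
have a10 : a1 = 0%N.
  move/eqP: tight; rewrite Z eq_sym oppr_eq0 !mulf_eq0 invr_eq0 expf_eq0 /=.
  by rewrite (gt_eqF k0) (gt_eqF b0) (gt_eqF c_gt0) /= !orbF pnatr_eq0 => /eqP.
have thDE : thD = - k%:R.
  move/eqP: Z; rewrite mulf_eq0 (gt_eqF F1) /= a10 add0r divr1 addr_eq0.
  by move/eqP.
rewrite thDE in w_cos.
by apply: nbip; apply: (bipartite_of_eigenvalue_opp_valency x w_cos).
Qed.

End LocallyCliques.

(** * The two families *)

Theorem corollary5p6 (R : rcfType) (T : finType) (e : rel T)
    (p : nat -> nat -> nat -> nat) (theta : nat -> R)
    (hDR : distance_regular e p)
    (htheta : ordered_eigenvalues e theta)
    (htheta0 : theta 0%N = (valency p)%:R)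
    (htight : tight e p theta)
    (b : R) (hb : b = (b_ p 1)%:R / (1 + theta 1%N)) (hb2 : 2 <= b) :
  ((forall x : T, is_OA_block_graph (@local_graph T e x)) ->
   (valency p)%:R > (b + 1) ^+ 2 ->
   (c_ p 2)%:R <> (b + 1) ^+ 2)
  /\
  ((forall x : T, is_steiner_block_graph (@local_graph T e x)) ->
   (valency p)%:R > (b + 1) * (b + 2) ->
   (c_ p 2)%:R <> (b + 1) * (b + 2)).
Proof.
have [D3 nbip tightE] := htight; have [th_dec th_eig] := htheta.
have D1 : (1 <= diameter e)%N by rewrite (leq_trans _ D3).
have b_gt0 : 0 < b by rewrite (lt_le_trans _ hb2).
have b1_gt0 : (0 < b_ p 1)%N.
  by rewrite lt0n; apply: contraTneq b_gt0 => b10; rewrite hb b10 mul0r ltxx.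
have s_gt0 : 0 < 1 + theta 1%N.
  by move: b_gt0; rewrite hb pmulr_rgt0 ?ltr0n // invr_gt0.
have th1_lt : theta 1%N < (valency p)%:R by rewrite -htheta0 th_dec.
have th1_eig : eigenvalue (adjacency_mx R e) (theta 1%N) by apply/th_eig; exists 1%N.
have thD_eig : eigenvalue (adjacency_mx R e) (theta (diameter e)).
  by apply/th_eig; exists (diameter e).
have [x _] : exists x : T, x \in T.
  apply/card_gt0P; rewrite lt0n; apply: contraTneq D3 => T0.
  by rewrite /diameter big_pred0 // => x; have := fintype0 x T0.
have valency_gt0 c : 0 <= c -> c < (valency p)%:R :> R -> (0 < valency p)%N.
  by move=> c_ge0 ck; rewrite -(ltr0n R) (le_lt_trans c_ge0).
have local_pg (Q : finType) (L : Q -> {set T}) m r a (kg : (0 < valency p)%N)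
    (pg : partial_geometry [set y | e x y] L m r a)
    (eL : forall y z, e x y -> e x z -> e y z = (y != z) && collinear L y z) :
    (1 < m)%N -> (1 < r)%N -> (m%:R = b + 1) /\ ((1 < a)%N ->
      (a < m)%N || (2 < a)%N -> (a.+1 < r)%N -> c_ p 2 <> (m * a.+1)%N).
  move=> m_gt1 r_gt1.
  have [mE c2] := tight_locally_pg hDR D3 b1_gt0 kg pg eL m_gt1 r_gt1
    th1_eig thD_eig th1_lt s_gt0 tightE.
  by split=> //; rewrite hb -mE mulfK ?subrK // gt_eqF.
split=> local_x k_big c2.
  have kg : (0 < valency p)%N.
    by apply: valency_gt0 k_big; rewrite exprn_ge0 // addr_ge0 // ltW.
  have [m [q [M [M_oa /local_graph_embedding[g [g_inj gX ge]]]]]] := local_x x.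
  have kq : valency p = (q ^ 2)%N.
    by rewrite -(card_neighbours hDR x D1) -gX card_imset // cardsT card_ord.
  (* With at most one row the block graph is a disjoint union of cliques,
  whose sizes need not be [q]; no partial geometry is needed then. *)
  have [m_le1|m_gt1] := leqP m 1.
    apply: (tight_not_locally_cliques hDR D3 b1_gt0 kg (x := x)
      thD_eig s_gt0 tightE nbip).
    have gP y : e x y -> exists j, y = g j.
      move=> xy; have : y \in g @: [set: 'I_(q ^ 2)] by rewrite gX inE.
      by case/imsetP=> j _ ->; exists j.
    move=> u v z /gP[iu ->] /gP[iv ->] /gP[iz ->]; rewrite !ge.
    move=> /andP[_ /existsP[s /eqP Ms]] /andP[_ /existsP[t /eqP Mt]] nvz.
    apply/andP; split; first by apply: contraNneq nvz => ->.
    apply/existsP; exists s; rewrite -Ms (_ : s = t) ?Mt //.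
    apply: val_inj => /=; have := leq_trans (ltn_ord s) m_le1.
    by have := leq_trans (ltn_ord t) m_le1; rewrite !ltnS !leqn0 => /eqP-> /eqP->.
  have q_gt1 : (1 < q)%N.
    have : (1 < q ^ 2)%N.
      rewrite -kq -(ltr_nat R) (le_lt_trans _ k_big) //.
      by rewrite exprn_ege1 // lerDr ltW.
    by case: (q) => [|[|]].
  have gL := pg_imset g_inj (OA_partial_geometry M_oa m_gt1).
  rewrite gX in gL.
  have [|mE c2_neq] := local_pg _ _ _ _ _ kg gL _ m_gt1 q_gt1.
    move=> y z; rewrite -[e x y]in_set -[e x z]in_set -gX.
    move=> /imsetP[i _ ->] /imsetP[j _ ->].
    by rewrite ge OA_block_graphE collinear_imset // (inj_eq g_inj).
  have m_gt2 : (2 < m)%N by rewrite -(ltr_nat R) mE -subr_gt0; lra.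
  have mK : m.-1.+1 = m by rewrite prednK // ltnW.
  apply: c2_neq; rewrite ?mK ?leqnn //.
  - by rewrite -ltnS mK.
  - by rewrite -(ltr_nat R) -(@ltr_pXn2r R 2) ?nnegrE ?ler0n // -!natrX -kq natrX mE.
  by apply/eqP; rewrite -(eqr_nat R) c2 natrM mE expr2.
have kg : (0 < valency p)%N.
  by apply: valency_gt0 k_big; rewrite mulr_ge0 // addr_ge0 // ltW.
have [m [q [B [B_steiner /local_graph_embedding[g [g_inj gX ge]]]]]] := local_x x.
have kB : valency p = #|[set: block B]|.
  by rewrite -(card_neighbours hDR x D1) -gX card_imset.
(* With [q <= 1] there are at most two blocks; this excludes the degenerate
Steiner systems. *)
have k_gt2 : (2 < valency p)%N.
  by rewrite -(ltr_nat R) (le_lt_trans _ k_big) //; nra.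
have q_gt1 : (1 < q)%N.
  have : (2 < 2 ^ q)%N.
    apply: (leq_trans k_gt2); rewrite kB cardsT card_sig.
    apply: leq_trans (max_card _) _.
    by rewrite -cardsT -powersetT card_powerset cardsT card_ord.
  by case: (q) => [|[|]].
have m_gt1 := Steiner_block_size B_steiner q_gt1.
have pgB := Steiner_partial_geometry B_steiner q_gt1.
move: (q.-1 %/ m.-1)%N pgB => r pgB.
have [s _] : exists s : 'I_q, true by exists (Ordinal q_gt1).
have off := card_off_line pgB s; rewrite -kB in off.
have r_gt1 : (1 < r)%N.
  rewrite ltnNge; apply/negP => r_le1; move: off.
  have -> : (r * (m.-1 * r.-1) = 0)%N by case: (r) r_le1 => [|[|]] //; rewrite !muln0.
  move/eqP; rewrite muln_eq0 subn_eq0 leqNgt (leq_ltn_trans r_le1) /=.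
    by rewrite -leqn0 leqNgt ltnW.
  exact: ltnW.
have gL := pg_imset g_inj pgB; rewrite gX in gL.
have [|mE c2_neq] := local_pg _ _ _ _ _ kg gL _ m_gt1 r_gt1.
  move=> y z; rewrite -[e x y]in_set -[e x z]in_set -gX.
  move=> /imsetP[i _ ->] /imsetP[j _ ->].
  by rewrite ge (steiner_block_graphE B_steiner) collinear_imset // (inj_eq g_inj).
have m_gt2 : (2 < m)%N by rewrite -(ltr_nat R) mE -subr_gt0; lra.
apply: c2_neq.
- exact: ltnW.
- by rewrite m_gt2 orbT.
(* If [r] were at most [m.+1], then [off] would give [valency p <= m * m.+1]. *)
- have m_lt_k : (m * m.+1 < valency p)%N.
    by rewrite -(ltr_nat R) natrM -natr1 mE -addrA -[1 + 1]/2%:R.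
  rewrite ltnNge; apply/negP => r_le; move: m_lt_k; rewrite ltnNge => /negP; apply.
  have: ((valency p - r) * m <= (m.+1 * m.-1) * m)%N.
    by rewrite off mulnA leq_mul ?leq_mul // -subn1 leq_subLR add1n.
  rewrite leq_pmul2r ?(ltnW m_gt1) // leq_subLR => k_le.
  have -> : (m * m.+1 = m.+1 + m.+1 * m.-1)%N.
    by rewrite -mulnS prednK ?(ltnW m_gt1) // mulnC.
  by rewrite (leq_trans k_le) // leq_add2r.
by apply/eqP; rewrite -(eqr_nat R) c2 natrM -[m.+1%:R]natr1 mE; apply/eqP; ring.
Qed.
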